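(* Let $\sigma=\sigma_1\cdots\sigma_n$ be a turn sequence of length $n\ge 0$. Then its reachable set $A(\sigma)$ is $$A(\sigma)=\begin{cases}\{(a,0)\mid a\in\mathbb{Z},\ a\ge 1\} & \text{if } n=0,\\ Q^+((1+\lfloor n/2\rfloor,\lceil n/2\rceil)) & \text{if } \sigma \text{ is a staircase with } \sigma_1=\texttt{L},\\ Q^+((1+\lfloor n/2\rfloor,-\lceil n/2\rceil)) & \text{if } \sigma \text{ is a staircase with } \sigma_1=\texttt{R},\\ \bigcup_{a\in\{x^+_\sigma,x^-_\sigma\}}V^+((a,0))\ \cup\ \bigcup_{b\in\{y^+_\sigma,y^-_\sigma\}}H^+((0,b)) & \text{otherwise,}\end{cases}$$ where in the last case the unions range only over those of $x^+_\sigma,x^-_\sigma,y^+_\sigma,y^-_\sigma$ that exist. Moreover (in the last case) $x^+_\sigma$, $x^-_\sigma$, $y^+_\sigma$, $y^-_\sigma$ exist if and only if $\sigma$ has a right, left, up, down hook, respectively.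
   Context: A turn sequence is a finite word $\sigma=\sigma_1\cdots\sigma_n$ with $\sigma_i\in\{\texttt{L},\texttt{R}\}$ (left turn, right turn). A rectilinear chain realizes $\sigma$ if it is simple (no self-intersection), consists of $n+1$ axis-parallel segments of positive integer length, starts at the origin $o=(0,0)$ with its first segment heading east (direction $+x$), and at its $n$ successive bends makes the $90^\circ$ turns $\sigma_1,\dots,\sigma_n$ in order. Its endpoint $p\in\mathbb{Z}^2$ is said to be reachable by $\sigma$; $A(\sigma)\subseteq\mathbb{Z}^2$ is the set of all points reachable by $\sigma$. A staircase is a turn sequence whose turns alternate between $\texttt{L}$ and $\texttt{R}$ (no two consecutive equal turns). Hooks: a hook is a pair of consecutive equal turns $\sigma_i\sigma_{i+1}\in\{\texttt{LL},\texttt{RR}\}$; the associated hook segment is the segment of the chain between the $i$th and $(i+1)$st bends. The hook is an up, down, left, right hook if that segment, directed along the chain from $o$ to the endpoint, has direction $+y,-y,-x,+x$ respectively. (The direction depends only on $\sigma$: with $\delta_i=\#\texttt{L}-\#\texttt{R}$ among $\sigma_1,\dots,\sigma_i$, the segment following the $i$th turn has direction $+x,+y,-x,-y$ according to $\delta_i\equiv 0,1,2,3\pmod 4$.) For $p=(a,b)$: if $a\ne 0$, $V^+(p)=\{(a+\mathrm{sgn}(a)\, i,\ j)\mid i\in\mathbb{Z}_{\ge0},\ j\in\mathbb{Z}\}$; if $b\neq 0$, $H^+(p)=\{(i,\ b+\mathrm{sgn}(b)\, j)\mid i\in\mathbb{Z},\ j\in\mathbb{Z}_{\ge 0}\}$;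 if $a,b\ne 0$, $Q^+(p)=V^+(p)\cap H^+(p)$. $(x^+_\sigma,0)$ and $(x^-_\sigma,0)$ denote the points of $A(\sigma)$ closest to $o$ on the $+x$-axis $\{(a,0):a>0\}$ and on the $-x$-axis $\{(a,0):a<0\}$, if they exist; $(0,y^+_\sigma)$ and $(0,y^-_\sigma)$ denote the points of $A(\sigma)$ closest to $o$ on the $+y$-axis $\{(0,b):b>0\}$ and on the $-y$-axis $\{(0,b):b<0\}$, if they exist. *)

(* Defs.v *)
From HB Require Import structures.
From mathcomp Require Import all_boot all_order all_algebra.
From mathcomp Require Import all_classical all_reals.

Set Implicit Arguments.
Unset Strict Implicit.
Unset Printing Implicit Defensive.

Import Order.TTheory GRing.Theory Num.Theory.

Local Open Scope classical_set_scope.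
Local Open Scope ring_scope.

Inductive turn := TurnL | TurnR.

Definition bool_of_turn (t : turn) : bool := if t is TurnL then true else false.
Definition turn_of_bool (b : bool) : turn := if b then TurnL else TurnR.
Lemma bool_of_turnK : cancel bool_of_turn turn_of_bool.
Proof. by case. Qed.
HB.instance Definition _ := Equality.copy turn (can_type bool_of_turnK).

Definition point : Type := int * int.

Definition east : point := (1, 0).
Definition north : point := (0, 1).
Definition west : point := (-1, 0).
Definition south : point := (0, -1).

Definition rotate (d : point) (t : turn) : point :=
  if t is TurnL then (- d.2, d.1) else (d.2, - d.1).

(* Segments are numbered from 0: segment i joins vertex i to vertex i.+1 and
   comes after the first i turns. *)
Definition direction (s : seq turn) (i : nat) : point :=
  foldl rotate east (take i s).

(* l is the sequence of the lengths of the segments. *)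
Definition vertex (s : seq turn) (l : seq nat) (i : nat) : point :=
  \sum_(k < i) direction s k *+ nth 0%N l k.

Definition embed (R : realType) (p : point) : R * R := (p.1%:~R, p.2%:~R).

(* The closed segment [p, q] of the real plane. *)
Definition segment (R : realType) (p q : point) : set (R * R) :=
  [set ((1 - t) * (embed R p).1 + t * (embed R q).1,
        (1 - t) * (embed R p).2 + t * (embed R q).2)
   | t in [set t : R | 0 <= t <= 1]].

(* No self-intersection: two distinct segments can only meet when they are
   consecutive, and then only at their common bend. *)
Definition simple_chain (R : realType) (s : seq turn) (l : seq nat) : Prop :=
  forall (i j : nat) (z : R * R), (i < j)%N -> (j < size l)%N ->
    segment (vertex s l i) (vertex s l i.+1) z ->
    segment (vertex s l j) (vertex s l j.+1) z ->
    j = i.+1 /\ z = embed R (vertex s l j).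

Definition realizes (R : realType) (s : seq turn) (l : seq nat) : Prop :=
  [/\ size l = (size s).+1, all (fun k => 0 < k)%N l & simple_chain R s l].

Definition reachable (R : realType) (s : seq turn) : set point :=
  [set vertex s l (size l) | l in [set l | realizes R s l]].

Definition staircase (s : seq turn) : bool := sorted (fun t u => t != u) s.

(* With turns numbered from 0, the segment between turns i and i.+1 is
   segment i.+1. *)
Definition has_hook (s : seq turn) (d : point) : Prop :=
  exists i : nat, [/\ (i.+1 < size s)%N,
    nth TurnL s i = nth TurnL s i.+1 & direction s i.+1 = d].

(* Vplus p is meant for p.1 != 0, Hplus p for p.2 != 0, and Qplus p for both. *)
Definition Vplus (p : point) : set point :=
  [set (p.1 + Num.sg p.1 * i%:Z, j) | i in [set: nat] & j in [set: int]].
Definition Hplus (p : point) : set point :=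
  [set (i, p.2 + Num.sg p.2 * j%:Z) | i in [set: int] & j in [set: nat]].
Definition Qplus (p : point) : set point := Vplus p `&` Hplus p.

(* The points of A closest to the origin, for the Euclidean distance. *)
Definition closest (A : set point) : set point :=
  [set p | A p /\ forall q, A q -> p.1 ^+ 2 + p.2 ^+ 2 <= q.1 ^+ 2 + q.2 ^+ 2].

(* On a half-axis the distance to the origin is injective, so each of the
   following sets has at most one element: the number x^+, x^-, y^+ or y^- when
   it exists. *)
Definition xplus (R : realType) (s : seq turn) : set int :=
  [set a | closest (reachable R s `&` [set (x, 0) | x in [set x | 0 < x]]) (a, 0)].
Definition xminus (R : realType) (s : seq turn) : set int :=
  [set a | closest (reachable R s `&` [set (x, 0) | x in [set x | x < 0]]) (a, 0)].
Definition yplus (R : realType) (s : seq turn) : set int :=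
  [set b | closest (reachable R s `&` [set (0, y) | y in [set y | 0 < y]]) (0, b)].
Definition yminus (R : realType) (s : seq turn) : set int :=
  [set b | closest (reachable R s `&` [set (0, y) | y in [set y | y < 0]]) (0, b)].

(* Main.v *)
(* A set S of lattice points that is closed under steps to the east and under
   the vertical unit edges of a chain can be moved one unit to the east, which
   gives a chain with the same turns.  Half-planes S show that reachable points
   can be moved away from the axes.  If the end p lies on the row of the start
   o, then some unit edge of the row between them is not on the chain (as
   n > 0), so the part above a cut through that edge can be moved up; this
   brings p off the axis in both directions, and makes room for one more
   segment.

   If p is not reachable from o by steps to the east and along vertical edges
   of the chain, then moving the set of points that are brings p one unit closer
   to the vertical axis; likewise for steps to the north and along horizontal
   edges.  If p is reachable in both ways, the two paths cannot cross, and this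
   forces all segments to head east or north.  Hence for a turn sequence that
   is not a staircase every reachable point can be moved to an axis.

   A right hook lets a chain reach the positive x-axis: let the chain grow, each
   segment ending beyond all previous ones, up to the hook, and come back to the
   row of o after it.  Conversely, in a chain without right hook each return to
   a row after an excursion is further to the left. *)

Require Import Defs.
From mathcomp Require Import all_boot all_order all_algebra.
From mathcomp Require Import all_classical all_reals.
From mathcomp Require Import zify.

Set Implicit Arguments.
Unset Strict Implicit.
Unset Printing Implicit Defensive.

Import Order.TTheory GRing.Theory Num.Theory.

Local Open Scope classical_set_scope.
Local Open Scope ring_scope.

Local Notation point := Defs.point.
Local Notation segment := (@Defs.segment).

(** * Lattice chains given by directions and vertices *)

Definition vert (d : point) : bool := d.1 == 0.

(** The length of the segment stays implicit: in each of the four directions only linear constraints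
    on the coordinates remain, which suits linear arithmetic. *)
Definition link (d p q : point) : Prop :=
  [\/ [/\ d = east, p.1 < q.1 & p.2 = q.2],
      [/\ d = west, q.1 < p.1 & p.2 = q.2],
      [/\ d = north, p.1 = q.1 & p.2 < q.2]
    | [/\ d = south, p.1 = q.1 & q.2 < p.2]].

(* The bounding box of p and q, which is the segment [p, q] when it is parallel
   to an axis. *)
Definition on (p q z : point) : bool :=
  ((p.1 <= z.1 <= q.1) || (q.1 <= z.1 <= p.1)) &&
  ((p.2 <= z.2 <= q.2) || (q.2 <= z.2 <= p.2)).

(* The start v 0 is arbitrary, so that chains can be moved and reflected. *)
Definition chain (n : nat) (D v : nat -> point) : Prop :=
  [/\ forall i, (i <= n)%N -> link (D i) (v i) (v i.+1),
      forall i, (i < n)%N -> vert (D i.+1) = ~~ vert (D i)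
    & forall i j (z : point), (i < j)%N -> (j <= n)%N ->
        on (v i) (v i.+1) z -> on (v j) (v j.+1) z -> j = i.+1 /\ z = v j].

Definition reach (n : nat) (D : nat -> point) (p : point) : Prop :=
  exists2 v, chain n D v & p = v n.+1 - v 0%N.

Lemma pointE (p q : point) : p.1 = q.1 -> p.2 = q.2 -> p = q.
Proof. by case: p q => ? ? [? ?] /= -> ->. Qed.

Lemma link_vert d p q : link d p q -> vert d = (p.1 == q.1).
Proof. by case=> -[-> h1 h2]; rewrite /vert /=; lia. Qed.

(** A unit edge is named by its lower end, in [hedge] by its left end; having both ends on one
    segment puts the whole edge on it. *)
Definition vedge n (v : nat -> point) (z : point) : Prop :=
  exists2 i, (i <= n)%N & on (v i) (v i.+1) z && on (v i) (v i.+1) (z.1, z.2 + 1).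
Definition hedge n (v : nat -> point) (z : point) : Prop :=
  exists2 i, (i <= n)%N & on (v i) (v i.+1) z && on (v i) (v i.+1) (z.1 + 1, z.2).

(** * Moving a set of lattice points to the east *)

Section Shift.
Variables (n : nat) (D v : nat -> point) (S : point -> Prop).
Hypotheses (cv : chain n D v).
Hypothesis SE : forall z : point, S z -> S (z.1 + 1, z.2).
Hypothesis SV : forall z : point, vedge n v z -> S z <-> S (z.1, z.2 + 1).

Definition shift (z : point) : point := if `[< S z >] then (z.1 + 1, z.2) else z.

Lemma shift2 (z : point) : (shift z).2 = z.2.
Proof. by rewrite /shift; case: ifP. Qed.

Lemma S_right (z z' : point) : z.2 = z'.2 -> z.1 <= z'.1 -> S z -> S z'.
Proof.
case: z z' => x y [x' y'] /= <- le_x Sz.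
have -> : x' = x + `|x' - x|%N%:Z by lia.
elim: `|x' - x|%N => [|k IHk]; first by rewrite addr0.
by have := SE IHk; rewrite /=; congr (S (_, _)); lia.
Qed.

(** The order on a row could only be lost if the left point moved and the right one stayed, which
    [SE] excludes. *)
Lemma shift_lt (z z' : point) : z.2 = z'.2 -> z.1 < z'.1 -> (shift z).1 < (shift z').1.
Proof.
move=> e lt_z; rewrite /shift.
case: asboolP => Sz; case: asboolP => Sz' //=; try lia.
by case: Sz'; apply: (S_right e) => //; lia.
Qed.

(** [SV] passes membership along the unit edges between two points of a vertical segment, so such a
    segment moves as a whole or not at all. *)
Lemma S_seg i (z z' : point) : (i <= n)%N -> on (v i) (v i.+1) z -> on (v i) (v i.+1) z' ->
  z.1 = z'.1 -> S z -> S z'.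
Proof.
have main k : forall x y : int, (i <= n)%N -> on (v i) (v i.+1) (x, y) ->
    on (v i) (v i.+1) (x, y + k%:Z) -> S (x, y) <-> S (x, y + k%:Z).
  elim: k => [|k IHk] x y le_in o1 o2; first by rewrite addr0.
  have o3 : on (v i) (v i.+1) (x, y + k%:Z) by move: o1 o2; rewrite /on /=; lia.
  have -> : y + k.+1%:Z = y + k%:Z + 1 by lia.
  rewrite (IHk x y) //; apply: (SV (z := (x, y + k%:Z))).
  by exists i => //; rewrite o3 /=; move: o2; congr on; congr (_, _); lia.
case: z z' => x y [x' y'] le_in o1 o2 /= ex; subst x'.
case: (lerP y y') => le_y.
  have e : y' = y + `|y' - y|%N%:Z by lia.
  by rewrite e in o2 *; rewrite -(main _ _ _ le_in o1 o2).
have e : y = y' + `|y - y'|%N%:Z by lia.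
by rewrite e in o1 *; rewrite -(main _ _ _ le_in o2 o1).
Qed.

Lemma shift_link i : (i <= n)%N -> link (D i) (shift (v i)) (shift (v i.+1)).
Proof.
move=> le_in; have [lk _ _] := cv.
have := lk _ le_in; have := @S_seg i (v i) (v i.+1) le_in.
have := @S_seg i (v i.+1) (v i) le_in.
have o1 : on (v i) (v i.+1) (v i) by rewrite /on; lia.
have o2 : on (v i) (v i.+1) (v i.+1) by rewrite /on; lia.
move=> /(_ o2 o1) h1 /(_ o1 o2) h2 [] [dE l1 l2].
- by constructor 1; rewrite !shift2; split=> //; apply: shift_lt.
- by constructor 2; rewrite !shift2; split=> //; apply: shift_lt.
- constructor 3; rewrite !shift2; split=> //; rewrite /shift.
  have [h3 h4] := (h1 (esym l1), h2 l1).
  by rewrite (asbool_equiv_eq (conj h4 h3)); case: ifP => _ /=; rewrite l1.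
- constructor 4; rewrite !shift2; split=> //; rewrite /shift.
  have [h3 h4] := (h1 (esym l1), h2 l1).
  by rewrite (asbool_equiv_eq (conj h4 h3)); case: ifP => _ /=; rewrite l1.
Qed.

(* The trace of a segment on the row of z, as an interval [w1, w2] that is a
   single point for a vertical segment. *)
Lemma shift_on i (z : point) : (i <= n)%N -> on (shift (v i)) (shift (v i.+1)) z ->
  exists w1 w2 : point, [/\ w1.2 = z.2 /\ w2.2 = z.2,
     (forall w : point, w.2 = z.2 -> w1.1 <= w.1 <= w2.1 -> on (v i) (v i.+1) w),
     w1.1 <= w2.1, (shift w1).1 <= z.1 <= (shift w2).1 & vert (D i) -> w1 = w2].
Proof.
move=> le_in; have [lk _ _] := cv; have := shift_link le_in.
have o1 : on (v i) (v i.+1) (v i) by rewrite /on; lia.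
case: (lk _ le_in) => -[dE l1 l2]; rewrite /link dE => -[] [// _]; rewrite !shift2 => k1 k2;
  rewrite {1}/on !shift2 => oz.
- exists (v i), (v i.+1); split; rewrite ?/vert //; try lia.
  by move=> w; rewrite /on; lia.
- exists (v i.+1), (v i); split; rewrite ?/vert //; try lia.
  by move=> w; rewrite /on; lia.
- have ow : on (v i) (v i.+1) ((v i).1, z.2) by rewrite /on /=; lia.
  have e : (shift ((v i).1, z.2)).1 = (shift (v i)).1.
    have := S_seg le_in ow o1 erefl; have := S_seg le_in o1 ow erefl.
    rewrite /shift; case: asboolP => s1; case: asboolP => s2 //=; tauto.
  exists ((v i).1, z.2), ((v i).1, z.2); split=> //=; try (rewrite e; lia).
  by move=> w; rewrite /on; lia.
- have ow : on (v i) (v i.+1) ((v i).1, z.2) by rewrite /on /=; lia.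
  have e : (shift ((v i).1, z.2)).1 = (shift (v i)).1.
    have := S_seg le_in ow o1 erefl; have := S_seg le_in o1 ow erefl.
    rewrite /shift; case: asboolP => s1; case: asboolP => s2 //=; tauto.
  exists ((v i).1, z.2), ((v i).1, z.2); split=> //=; try (rewrite e; lia).
  by move=> w; rewrite /on; lia.
Qed.

(** If two shifted segments meet in [z], the traces of the original ones on the row of [z] are
    intervals that overlap, since [shift] is strictly increasing on rows. So the original segments
    meet, and their simplicity applies. *)
Lemma chain_shift : chain n D (fun i => shift (v i)).
Proof.
have [lk alt sim] := cv; split=> // [i|i j z lt_ij le_jn]; first exact: shift_link.
have le_in : (i <= n)%N by lia.
move=> /(shift_on le_in) [w1 [w2 [[e1 e2] h12 l12 /andP[s1 s2] v12]]].
move=> /(shift_on le_jn) [w3 [w4 [[e3 e4] h34 l34 /andP[s3 s4] v34]]].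
have l14 : w1.1 <= w4.1.
  by case: lerP => // /(shift_lt (etrans e4 (esym e1))); lia.
have l32 : w3.1 <= w2.1.
  by case: lerP => // /(shift_lt (etrans e2 (esym e3))); lia.
(* The larger of the two left ends is common to both intervals. *)
have [j_eq w_eq] : j = i.+1 /\ ((if w1.1 <= w3.1 then w3.1 else w1.1), z.2) = v j.
  by apply: (sim i j) => //; [apply: h12 | apply: h34] => //=; case: ifP => /=; lia.
split=> //; rewrite -w_eq.
(* Of two consecutive segments one is vertical; its trace is a single point, whose image must be
   [z]. *)
have : vert (D i) \/ vert (D j).
  by rewrite j_eq alt; [case: (vert (D i)); [left | right] | lia].
case=> [/v12|/v34] wE.
- subst w2; have -> : (if w1.1 <= w3.1 then w3.1 else w1.1) = w1.1 by case: ifP; lia.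
  have -> : (w1.1, z.2) = w1 by apply: pointE.
  by apply: pointE; [lia | rewrite shift2].
- subst w4; have -> : (if w1.1 <= w3.1 then w3.1 else w1.1) = w3.1 by case: ifP; lia.
  have -> : (w3.1, z.2) = w3 by apply: pointE.
  by apply: pointE; [lia | rewrite shift2].
Qed.

End Shift.

(** * Symmetries and stretching *)

Definition transpose (z : point) : point := (z.2, z.1).
Definition reflect (z : point) : point := (- z.1, z.2).

Lemma transposeK : involutive transpose. Proof. by case. Qed.
Lemma reflectK : involutive reflect.
Proof. by move=> z; apply: pointE; rewrite /= ?opprK. Qed.

Lemma chain_transpose n D v : chain n D v ->
  chain n (fun i => transpose (D i)) (fun i => transpose (v i)).
Proof.
move=> [lk alt sim]; split=> [i le_in|i lt_in|i j z lt_ij le_jn o1 o2].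
- by case: (lk i le_in) => -[-> h1 h2]; rewrite /link /=;
    [constructor 3|constructor 4|constructor 1|constructor 2]; split.
- have := alt _ lt_in; have [h1 h2] := (lk i (ltnW lt_in), lk _ lt_in).
  by case: h1 => -[-> _ _]; case: h2 => -[-> _ _].
- have [||-> e] := sim i j (transpose z) lt_ij le_jn.
  + by move: o1; rewrite /on /= andbC.
  + by move: o2; rewrite /on /= andbC.
  by split=> //; rewrite -e transposeK.
Qed.

Lemma chain_reflect n D v : chain n D v ->
  chain n (fun i => reflect (D i)) (fun i => reflect (v i)).
Proof.
move=> [lk alt sim]; split=> [i le_in|i lt_in|i j z lt_ij le_jn o1 o2].
- case: (lk i le_in) => -[-> h1 h2]; rewrite /link /=;
    [constructor 2|constructor 1|constructor 3|constructor 4]; split=> //; lia.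
- have := alt _ lt_in; have [h1 h2] := (lk i (ltnW lt_in), lk _ lt_in).
  by case: h1 => -[-> _ _]; case: h2 => -[-> _ _].
- have [||-> e] := sim i j (reflect z) lt_ij le_jn.
  + by move: o1; rewrite /on /=; lia.
  + by move: o2; rewrite /on /=; lia.
  by split=> //; rewrite -e reflectK.
Qed.

Lemma reach_transpose n D p : reach n D p ->
  reach n (fun i => transpose (D i)) (transpose p).
Proof. by move=> [v cv ->]; eexists; first exact: chain_transpose cv. Qed.

Lemma reach_reflect n D p : reach n D p ->
  reach n (fun i => reflect (D i)) (reflect p).
Proof.
move=> [v cv ->]; eexists; first exact: chain_reflect cv.
by apply: pointE => //=; lia.
Qed.

Lemma transpose_dirK (D : nat -> point) :
  (fun i => transpose (transpose (D i))) = D.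
Proof. by apply/funext => i; exact: transposeK. Qed.

Lemma reflect_dirK (D : nat -> point) : (fun i => reflect (reflect (D i))) = D.
Proof. by apply/funext => i; exact: reflectK. Qed.

(** Any other segment through [v 0] would have to be segment 1 and to meet segment 0 there in [v 1],
    which differs from [v 0]. *)
Lemma chain_start n D v i : chain n D v -> (i <= n)%N ->
  on (v i) (v i.+1) (v 0%N) -> i = 0%N.
Proof.
move=> [lk _ sim]; case: i => // i le_in o1.
have o0 : on (v 0%N) (v 1%N) (v 0%N) by rewrite /on; lia.
have [i0 e] := sim 0%N i.+1 (v 0%N) isT le_in o0 o1.
move: e; have -> : i = 0%N by lia.
by case: (lk 0%N isT) => -[_ h1 h2] e; move: h1 h2; rewrite e; lia.
Qed.

Lemma chain_end n D v i : chain n D v -> (i <= n)%N ->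
  on (v i) (v i.+1) (v n.+1) -> i = n.
Proof.
move=> [lk _ sim] le_in o1; apply/eqP; apply: contraT => ne_in.
have o0 : on (v n) (v n.+1) (v n.+1) by rewrite /on; lia.
have [ni e] := sim i n (v n.+1) ltac:(lia) (leqnn n) o1 o0.
by case: (lk n (leqnn n)) => -[_ h1 h2]; move: h1 h2; rewrite e; lia.
Qed.

Lemma reach_shift n D v (S : point -> Prop) : chain n D v ->
  (forall z : point, S z -> S (z.1 + 1, z.2)) ->
  (forall z : point, vedge n v z -> S z <-> S (z.1, z.2 + 1)) ->
  reach n D (shift S (v n.+1) - shift S (v 0%N)).
Proof.
by move=> cv SE SV; eexists; first exact: chain_shift cv SE SV.
Qed.

(** * Moving a reachable point away from the axes *)

Definition outward (a : int) : int := if 0 < a then a + 1 else a - 1.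

Lemma reach_outward1 n D (a b : int) : a != 0 -> reach n D (a, b) ->
  reach n D (outward a, b).
Proof.
move=> a0 [v cv e]; have [e1 e2] : (v n.+1).1 - (v 0%N).1 = a /\ (v n.+1).2 - (v 0%N).2 = b.
  by case: e => -> ->.
(* The open half-plane to the right of the left one of the two ends moves the other end only. *)
pose m : int := if 0 < a then (v 0%N).1 else (v n.+1).1.
have := @reach_shift n D v (fun z => m < z.1) cv.
case=> [z|z _|v' cv' e']; rewrite /=; [lia | by [] |].
exists v' => //; rewrite -e' /shift.
rewrite /m /outward {m cv' e'}.
by apply: pointE; case: (ltP 0 a) => a1; case: asboolP; case: asboolP => /=; lia.
Qed.

Lemma reach_outward n D (a b : int) k : a != 0 -> reach n D (a, b) ->
  reach n D (iter k outward a, b).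
Proof.
move=> a0 rab; suff: iter k outward a != 0 /\ reach n D (iter k outward a, b) by case.
elim: k => //= k [nz IHk]; split; last exact: reach_outward1.
by rewrite /outward; case: ltP; lia.
Qed.

Lemma iter_outward (a : int) k : a != 0 ->
  iter k outward a = if 0 < a then a + k%:Z else a - k%:Z.
Proof.
move=> a0; elim: k => [|k /= ->]; first by case: ltP => _ /=; lia.
by rewrite /outward; case: (ltP 0 a) => ?; case: ltP; lia.
Qed.

(** If every unit edge of the row between the two ends were on the chain, all of them would lie on
    the first segment: the only other segment that can meet it is segment 1, which is vertical. The
    first segment would then contain the end, against [n > 0]. *)
Lemma row_gap n D v : (0 < n)%N -> chain n D v ->
  (v 0%N).2 = (v n.+1).2 -> (v 0%N).1 < (v n.+1).1 ->
  exists c : int, (v 0%N).1 <= c < (v n.+1).1 /\ ~ hedge n v (c, (v 0%N).2).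
Proof.
move=> n0 cv ey lx; apply: contrapT => no_gap.
have [lk alt sim] := cv.
have cov c : (v 0%N).1 <= c < (v n.+1).1 -> hedge n v (c, (v 0%N).2).
  by move=> hc; apply: contrapT => nh; apply: no_gap; exists c.
have main k : (v 0%N).1 + k%:Z < (v n.+1).1 ->
    on (v 0%N) (v 1%N) ((v 0%N).1 + k.+1%:Z, (v 0%N).2).
  elim: k => [|k IHk] lt_k.
    have [|i le_in /andP[/= o1 o2]] := cov (v 0%N).1; first by lia.
    have i0 : i = 0%N by apply: (chain_start cv le_in); move: o1; congr on; apply: pointE.
    by subst i.
  have [|i le_in /andP[/= o1 o2]] := cov ((v 0%N).1 + k.+1%:Z); first by lia.
  have o3 := IHk ltac:(lia).
  case: (posnP i) => [i0|i_pos].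
    by subst i; move: o2; congr on; apply: pointE => /=; lia.
  have [i1 _] := sim 0%N i _ i_pos le_in o3 o1.
  have := alt 0%N n0; rewrite -i1 (link_vert (lk _ le_in)).
  rewrite (link_vert (lk 0%N isT)).
  have o0 : on (v 0%N) (v 1%N) (v 0%N) by rewrite /on; lia.
  by move: o0 o1 o2 o3; rewrite /on /=; lia.
pose k := `|((v n.+1).1 - (v 0%N).1 - 1)%R|%N.
have k1 : (v n.+1).1 = (v 0%N).1 + k.+1%:Z by rewrite /k; lia.
have := main k ltac:(lia); rewrite -k1 ey -surjective_pairing.
by move=> /(chain_end cv (leq0n n)); lia.
Qed.

Lemma vedge_transpose n v z :
  vedge n (fun i => transpose (v i)) z <-> hedge n v (transpose z).
Proof.
split=> -[i le_in /andP[o1 o2]]; exists i => //;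
by move: o1 o2; rewrite /on /=; lia.
Qed.

Lemma hedge_transpose n v z :
  hedge n (fun i => transpose (v i)) z <-> vedge n v (transpose z).
Proof.
split=> -[i le_in /andP[o1 o2]]; exists i => //;
by move: o1 o2; rewrite /on /=; lia.
Qed.

Lemma reach_outward2 n D (a b : int) k : b != 0 -> reach n D (a, b) ->
  reach n D (a, iter k outward b).
Proof.
move=> b0 /reach_transpose/(reach_outward k b0)/reach_transpose.
by rewrite transpose_dirK.
Qed.

Lemma reach_off_axis_pos n D (a : int) : (0 < n)%N -> 0 < a -> reach n D (a, 0) ->
  reach n D (a, 1) /\ reach n D (a, - 1).
Proof.
move=> n0 a0 [v cv e].
have [e1 e2] : (v n.+1).1 - (v 0%N).1 = a /\ (v n.+1).2 - (v 0%N).2 = 0.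
  by case: e => -> ->.
have [||c [hc gap]] := row_gap n0 cv; [lia|lia|].
have ct := chain_transpose cv.
set y0 := (v 0%N).2 in e2 gap.
(* After transposition the first coordinate is the height. Both sets contain everything above the
   row of the start, and the part of that row on one side of the missing edge: [S1] moves the end
   up, [S2] the start. *)
pose S1 (z : point) := y0 < z.1 \/ z.1 = y0 /\ c < z.2.
pose S2 (z : point) := y0 < z.1 \/ z.1 = y0 /\ z.2 <= c.
have gap' (z : point) : vedge n (fun i => transpose (v i)) z -> z.1 = y0 -> z.2 != c.
  move=> /vedge_transpose hz zy; apply/eqP => zc; apply: gap; move: hz.
  by congr hedge; apply: pointE.
have H1 : reach n D (a, 1).
  rewrite -(transpose_dirK D); apply: (@reach_transpose _ _ (1, a)).
  have := @reach_shift n _ _ S1 ct; case=> [z|z /gap' hz|v' cv' e'].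
  - by rewrite /S1 /=; lia.
  - by rewrite /S1 /=; lia.
  exists v' => //; rewrite -e' /shift /S1.
  by apply: pointE; case: asboolP; case: asboolP => /=; lia.
have H2 : reach n D (a, - 1).
  rewrite -(transpose_dirK D); apply: (@reach_transpose _ _ (- 1, a)).
  have := @reach_shift n _ _ S2 ct; case=> [z|z /gap' hz|v' cv' e'].
  - by rewrite /S2 /=; lia.
  - by rewrite /S2 /=; lia.
  exists v' => //; rewrite -e' /shift /S2.
  by apply: pointE; case: asboolP; case: asboolP => /=; lia.
by split.
Qed.

Lemma reach_off_axis n D (a : int) : (0 < n)%N -> a != 0 -> reach n D (a, 0) ->
  reach n D (a, 1) /\ reach n D (a, - 1).
Proof.
move=> n0 a0 ra; case: (ltP 0 a) => a1; first exact: reach_off_axis_pos.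
have [|/reach_reflect r1 /reach_reflect r2] := reach_off_axis_pos n0 _ (reach_reflect ra).
  by rewrite /=; lia.
by move: r1 r2; rewrite reflect_dirK /reflect /= !opprK.
Qed.

(** One unit up or down leaves the axis; from there both coordinates can grow in absolute value one
    unit at a time. *)
Lemma reach_Vplus n D (a : int) : (0 < n)%N -> a != 0 -> reach n D (a, 0) ->
  forall p, Vplus (a, 0) p -> reach n D p.
Proof.
move=> n0 a0 ra p [k _ [y _ <-]] /=.
have -> : a + Num.sg a * k%:Z = iter k outward a.
  rewrite iter_outward //; case: (ltP 0 a) => a1.
    by rewrite gtr0_sg //; lia.
  by rewrite ltr0_sg //; lia.
apply: reach_outward => //; have [r1 r2] := reach_off_axis n0 a0 ra.
have [y0|y0|->//] := ltgtP y 0.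
- have -> : y = iter `|(- 1 - y)%R|%N outward (- 1) by rewrite iter_outward //=; lia.
  exact: reach_outward2.
- have -> : y = iter `|(y - 1)%R|%N outward 1 by rewrite iter_outward //=; lia.
  exact: reach_outward2.
Qed.

(** * Adding a segment *)

Lemma chain_snoc n D v q : chain n D v ->
  link (D n.+1) (v n.+1) q -> vert (D n.+1) = ~~ vert (D n) ->
  (forall j (z : point), (j <= n)%N -> on (v j) (v j.+1) z -> on (v n.+1) q z ->
     j = n /\ z = v n.+1) ->
  chain n.+1 D (fun i => if (i <= n.+1)%N then v i else q).
Proof.
move=> [lk alt sim] lkq altq dis.
split=> [i le_in|i lt_in|i j z lt_ij le_jn].
- rewrite le_in; case: ltnP => le_i; first exact: lk.
  by have -> : i = n.+1 by lia.
- by case: (ltnP i n) => lt_i; [apply: alt | have -> : i = n by lia].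
have [h1 h2] : (i <= n.+1)%N /\ (i < n.+1)%N by lia.
rewrite h1 h2 le_jn; case: (ltnP j n.+1) => le_j; first exact: sim.
have -> : j = n.+1 by lia.
by move=> oi oj; have [|-> ->] := dis _ _ _ oi oj; first lia.
Qed.

(** The shift fixes the end and moves away the point to its right, so the unit edge between them
    becomes free and can carry the new segment. *)
Lemma reach_snoc_east n D v (S : point -> Prop) : chain n D v ->
  (forall z : point, S z -> S (z.1 + 1, z.2)) ->
  (forall z : point, vedge n v z -> S z <-> S (z.1, z.2 + 1)) ->
  D n.+1 = east -> vert (D n) ->
  ~ S (v n.+1) -> S ((v n.+1).1 + 1, (v n.+1).2) ->
  reach n.+1 D (((v n.+1).1 + 1, (v n.+1).2) - shift S (v 0%N)).
Proof.
move=> cv SE SV DE vn Sp Sp1; have cs := chain_shift cv SE SV.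
set p := v n.+1 in Sp Sp1 *.
have sp : shift S p = p by rewrite /shift; case: asboolP.
have sp1 : shift S (p.1 + 1, p.2) = (p.1 + 2, p.2).
  by rewrite /shift; case: asboolP => //= _; congr (_, _); lia.
suff cq : chain n.+1 D
    (fun i => if (i <= n.+1)%N then shift S (v i) else (p.1 + 1, p.2)).
  by eexists; first exact: cq; rewrite /= ltnn.
apply: chain_snoc => //; first by constructor 1; rewrite -/p sp /=; split=> //; lia.
  by rewrite DE vn.
move=> j z le_jn oj; rewrite -/p sp => oz.
have z2 : z.2 = p.2 by move: oz; rewrite /on /=; lia.
have z1 : z.1 = p.1 \/ z.1 = p.1 + 1 by move: oz; rewrite /on /=; lia.
have [w1 [w2 [[e1 e2] h12 l12 /andP[s1 s2] v12]]] := shift_on cv SE SV le_jn oj.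
(* A shifted segment that meets the new edge comes from one whose trace contains the old end. So it
   is the last segment, and as that is vertical, they meet in the end only. *)
have pw2 : p.1 <= w2.1.
  case: lerP => // lt; have := @shift_lt S SE w2 p (etrans e2 z2) lt.
  by rewrite sp; lia.
have pw1 : w1.1 <= p.1.
  case: lerP => // lt.
  have [lt1|eq1] : p.1 + 1 < w1.1 \/ w1.1 = p.1 + 1 by lia.
    have := @shift_lt S SE (p.1 + 1, p.2) w1 (esym (etrans e1 z2)) lt1.
    by rewrite sp1 /=; lia.
  have w1E : w1 = (p.1 + 1, p.2) by apply: pointE => //=; lia.
  by move: s1; rewrite w1E sp1 /=; lia.
have jn : j = n by apply: (chain_end cv le_jn); apply: h12; rewrite // -/p; lia.
subst j; split=> //.
have w12 := v12 vn; subst w2; have w1p : w1 = p by apply: pointE; lia.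
by move: s1 s2; rewrite w1p sp => s1 s2; apply: pointE; lia.
Qed.

(** With the half-plane to the right of the end as [S], the start moves exactly if it lies to the
    right of the end; for [a < 0] this compensates for the new unit segment. *)
Lemma reach_extend_east n D (a b : int) : D n.+1 = east -> vert (D n) ->
  reach n D (a, b) -> reach n.+1 D (if 0 <= a then a + 1 else a, b).
Proof.
move=> DE vn [v cv e].
have [e1 e2] : (v n.+1).1 - (v 0%N).1 = a /\ (v n.+1).2 - (v 0%N).2 = b.
  by case: e => -> ->.
have := @reach_snoc_east n D v (fun z => (v n.+1).1 < z.1) cv.
case=> // [z|||v' cv' e'] /=; [lia|lia|lia|].
exists v' => //; rewrite -e' /shift.
by apply: pointE; case: asboolP; case: ifP => /=; lia.
Qed.

(** The new unit segment going up is compensated by moving the start up: the set moved consists of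
    everything above the row and of the part of the row left of the missing edge, which contains the
    start but not the end. *)
Lemma reach_extend_north n D (a : int) : (0 < n)%N -> 0 < a ->
  D n.+1 = north -> ~~ vert (D n) -> D n \in [:: east; west] ->
  reach n D (a, 0) -> reach n.+1 D (a, 0).
Proof.
move=> n0 a0 DN vn Dn [v cv e].
have [e1 e2] : (v n.+1).1 - (v 0%N).1 = a /\ (v n.+1).2 - (v 0%N).2 = 0.
  by case: e => -> ->.
have [||c [hc gap]] := row_gap n0 cv; [lia|lia|].
have ct := chain_transpose cv.
set y0 := (v 0%N).2 in e2 gap.
pose S (z : point) := y0 < z.1 \/ z.1 = y0 /\ z.2 <= c.
have gap' (z : point) : vedge n (fun i => transpose (v i)) z -> z.1 = y0 -> z.2 != c.
  move=> /vedge_transpose hz zy; apply/eqP => zc; apply: gap; move: hz.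
  by congr hedge; apply: pointE.
rewrite -(transpose_dirK D); apply: (@reach_transpose _ _ (0, a)).
have := @reach_snoc_east n _ _ S ct.
case=> [z|z /gap' hz|||||v' cv' e']; try by rewrite /S /=; lia.
- by rewrite DN.
- by move: Dn; rewrite !inE => /orP[] /eqP ->.
exists v' => //; rewrite -e' /shift /S.
by apply: pointE; case: asboolP => /=; lia.
Qed.

(** * Non-crossing paths *)

(* The condition z <> p makes the paths stop at p; a y-path could otherwise run
   through p along the last segment of the chain. *)
Inductive xreach n (v : nat -> point) (o p : point) : point -> Prop :=
| xreach0 : xreach n v o p o
| xreachE (z : point) : xreach n v o p z -> z <> p ->
    xreach n v o p (z.1 + 1, z.2)
| xreachN (z : point) : xreach n v o p z -> z <> p -> vedge n v z ->
    xreach n v o p (z.1, z.2 + 1)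
| xreachS (z : point) : xreach n v o p (z.1, z.2 + 1) -> (z.1, z.2 + 1) <> p ->
    vedge n v z -> xreach n v o p z.

Definition yreach n (v : nat -> point) (o p z : point) : Prop :=
  xreach n (fun i => transpose (v i)) (transpose o) (transpose p) (transpose z).

Lemma xreach_inv n v (o p q : point) : xreach n v o p q -> q <> o ->
  [\/ xreach n v o p (q.1 - 1, q.2) /\ (q.1 - 1, q.2) <> p,
      [/\ xreach n v o p (q.1, q.2 - 1), (q.1, q.2 - 1) <> p & vedge n v (q.1, q.2 - 1)]
    | [/\ xreach n v o p (q.1, q.2 + 1), (q.1, q.2 + 1) <> p & vedge n v q]].
Proof.
case=> [//|z rz zp _|z rz zp ez _|z rz zp ez _].
- by constructor 1; rewrite /= addrK -surjective_pairing.
- by constructor 2; rewrite /= addrK -surjective_pairing.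
- by constructor 3.
Qed.

Lemma yreach_inv n v (o p q : point) : yreach n v o p q -> q <> o ->
  [\/ yreach n v o p (q.1, q.2 - 1) /\ (q.1, q.2 - 1) <> p,
      [/\ yreach n v o p (q.1 - 1, q.2), (q.1 - 1, q.2) <> p & hedge n v (q.1 - 1, q.2)]
    | [/\ yreach n v o p (q.1 + 1, q.2), (q.1 + 1, q.2) <> p & hedge n v q]].
Proof.
have tr_inj (z z' : point) : transpose z = transpose z' -> z = z'.
  exact: (inv_inj transposeK).
move=> /xreach_inv h qo; case: (h (fun e => qo (tr_inj _ _ e))).
- by case=> h1 h2; constructor 1; split=> // e; apply: h2; rewrite -e.
- case=> h1 h2 /vedge_transpose h3; constructor 2; split=> //.
  by move=> e; apply: h2; rewrite -e.
- case=> h1 h2 /vedge_transpose h3; constructor 3; split=> //.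
  by move=> e; apply: h2; rewrite -e.
Qed.

Section Crossing.
Variables (n : nat) (D v : nat -> point).
Hypothesis cv : chain n D v.

Lemma seg_vert i : (i <= n)%N -> vert (D i) = ((v i).1 == (v i.+1).1).
Proof. by move=> /(let: And3 lk _ _ := cv in lk i) /link_vert. Qed.

Lemma seg_horiz i : (i <= n)%N -> vert (D i) = ((v i).2 != (v i.+1).2).
Proof.
by case: cv => lk _ _ /lk; case=> -[-> h1 h2]; rewrite /vert /=; lia.
Qed.

Lemma seg_common_vert i j (z : point) : (i <= n)%N -> (j <= n)%N ->
  on (v i) (v i.+1) z -> on (v j) (v j.+1) z -> vert (D i) = vert (D j) -> i = j.
Proof.
have [_ alt sim] := cv.
have main k l : (k < l)%N -> (l <= n)%N -> on (v k) (v k.+1) z ->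
    on (v l) (v l.+1) z -> vert (D k) = vert (D l) -> False.
  by move=> lt_kl le_l ok ol; have [-> _] := sim _ _ _ lt_kl le_l ok ol; rewrite alt; lia.
move=> le_i le_j oi oj e; case: (ltngtP i j) => // [lt|lt].
  by case: (main _ _ lt le_j oi oj e).
by case: (main _ _ lt le_i oj oi (esym e)).
Qed.

(** The two vertical edges at [z] lie on one segment, so [z] is interior to it; but a horizontal
    segment can meet it only at one of its ends. *)
Lemma no_T_vert (z : point) : hedge n v z \/ hedge n v (z.1 - 1, z.2) ->
  vedge n v z -> vedge n v (z.1, z.2 - 1) -> False.
Proof.
have [lk alt sim] := cv.
move=> hz [i le_i /andP[/= o1 o2]] [j le_j /andP[/= o3 o4]].
have vi : vert (D i) by rewrite seg_horiz //; move: o1 o2; rewrite /on /=; lia.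
have vj : vert (D j) by rewrite seg_horiz //; move: o3 o4; rewrite /on /=; lia.
have o4' : on (v j) (v j.+1) z by move: o4; congr on; apply: pointE => /=; lia.
have ij : i = j by apply: (seg_common_vert le_i le_j o1 o4'); rewrite vi vj.
subst j; have [k le_k [vk ok]] : exists2 k, (k <= n)%N & ~~ vert (D k) /\ on (v k) (v k.+1) z.
  case: hz => -[k le_k /andP[/= o5 o6]]; exists k => //.
    by rewrite seg_vert //; split=> //; move: o5 o6; rewrite /on /=; lia.
  rewrite seg_vert //; split; first by move: o5 o6; rewrite /on /=; lia.
  by move: o6; congr on; apply: pointE => /=; lia.
have ends : z = v i \/ z = v i.+1.
  case: (ltngtP i k) => [lt|lt|e].
  - by have [-> ->] := sim _ _ _ lt le_k o1 ok; right.
  - by have [-> ->] := sim _ _ _ lt le_i ok o1; left.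
  - by move: vk; rewrite -e vi.
by move: o2 o3; case: ends => ->; rewrite /on /=; lia.
Qed.

End Crossing.

Lemma no_T_horiz n D v (z : point) : chain n D v ->
  vedge n v z \/ vedge n v (z.1, z.2 - 1) ->
  hedge n v z -> hedge n v (z.1 - 1, z.2) -> False.
Proof.
move=> /chain_transpose ct hz h1 h2.
apply: (no_T_vert (z := transpose z) ct).
- by case: hz => hz; [left | right]; apply/hedge_transpose; rewrite ?transposeK.
- by apply/vedge_transpose; rewrite transposeK.
- exact/vedge_transpose.
Qed.

(** Only segment 0 passes through the start, and it is either vertical or horizontal. *)
Lemma no_corner_start n D v (z : point) : chain n D v -> v 0%N = z ->
  vedge n v z \/ vedge n v (z.1, z.2 - 1) ->
  hedge n v z \/ hedge n v (z.1 - 1, z.2) -> False.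
Proof.
move=> cv e hv hh.
have v0 : vert (D 0%N).
  case: hv => -[i le_i /andP[/= o1 o2]].
    have i0 : i = 0%N by apply: (chain_start cv le_i); rewrite e.
    by subst i; rewrite (seg_horiz cv) //; move: o1 o2; rewrite /on /=; lia.
  have i0 : i = 0%N.
    by apply: (chain_start cv le_i); move: o2; congr on; rewrite e; apply: pointE => /=; lia.
  by subst i; rewrite (seg_horiz cv) //; move: o1 o2; rewrite /on /=; lia.
move: v0; rewrite (seg_vert cv) //.
case: hh => -[i le_i /andP[/= o1 o2]].
  have i0 : i = 0%N by apply: (chain_start cv le_i); rewrite e.
  by subst i; move: o1 o2; rewrite /on /=; lia.
have i0 : i = 0%N.
  by apply: (chain_start cv le_i); move: o2; congr on; rewrite e; apply: pointE => /=; lia.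
by subst i; move: o1 o2; rewrite /on /=; lia.
Qed.

Definition vrun n v (x y1 y2 : int) : Prop :=
  forall y : int, y1 <= y < y2 \/ y2 <= y < y1 -> vedge n v (x, y).

(* [E x] is the height at which the path enters column x. *)
Definition xpath n v (o p : point) (E : int -> int) : Prop :=
  [/\ o.1 <= p.1, E o.1 = o.2, E (p.1 + 1) = p.2
    & forall x : int, o.1 <= x <= p.1 -> vrun n v x (E x) (E (x + 1))].

(** Backtracking inside a column can be forgotten, since [vrun] only covers the edges between entry
    and exit: a vertical step changes the exit height of the last column, a step to the east opens a
    new column. *)
Lemma xreach_xpath n v o p q : xreach n v o p q -> exists E, xpath n v o q E.
Proof.
elim=> [|z _ [E [l1 e1 e2 r]] _|z _ [E [l1 e1 e2 r]] _ ez|z _ [E [l1 e1 e2 r]] _ ez].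
- by exists (fun=> o.2); split=> // x _ y; lia.
- exists (fun x => if x == z.1 + 2 then z.2 else E x); split=> /=; first lia.
  + by case: eqP => //; lia.
  + by case: eqP => //; lia.
  move=> x hx; rewrite /vrun; case: (eqVneq x (z.1 + 1)) => [->|nx].
    case: eqP => [|_]; first lia.
    case: eqP => [_|]; last lia.
    by rewrite e2 => y; lia.
  by do 2![case: eqP => [|_]; first lia]; apply: r; lia.
- exists (fun x => if x == z.1 + 1 then z.2 + 1 else E x); split=> //=.
  + by case: eqP => //; lia.
  + by case: eqP.
  move=> x hx y; case: eqP => [|_]; first lia.
  case: eqP => [xz|xz] hy; last by apply: (r x).
  have xz' : x = z.1 by lia.
  subst x; case: (eqVneq y z.2) => [->|ny]; first by rewrite -surjective_pairing.
  by apply: (r z.1); rewrite ?e2; lia.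
- move: l1 e1 e2 r => /= l1 e1 e2 r.
  exists (fun x => if x == z.1 + 1 then z.2 else E x); split=> //=.
  + by case: eqP => //; lia.
  + by case: eqP.
  move=> x hx y; case: eqP => [|_]; first lia.
  case: eqP => [xz|xz] hy; last by apply: (r x).
  have xz' : x = z.1 by lia.
  subst x; case: (eqVneq y z.2) => [->|ny]; first by rewrite -surjective_pairing.
  by apply: (r z.1); rewrite ?e2; lia.
Qed.

(* The cells to the north-west and to the north-east of a point z of a y-path
   cannot both lie below the x-path E.  The last two clauses make the invariant
   inductive: they forbid y-steps out of the corners of the x-path. *)
Definition above n v (o p : point) (E : int -> int) (z : point) : Prop :=
  o.2 <= z.2 /\ (z.1 < o.1 \/
   [/\ z.1 <= p.1, E z.1 <= z.2 \/ E (z.1 + 1) <= z.2,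
       z.2 = E z.1 -> E z.1 < E (z.1 + 1) -> ~ hedge n v z
     & z.2 = E (z.1 + 1) -> E (z.1 + 1) < E z.1 -> ~ hedge n v (z.1 - 1, z.2)]).

Section Above.
Variables (n : nat) (D v : nat -> point) (p : point) (E : int -> int).
Hypotheses (cv : chain n D v) (xp : xpath n v (v 0%N) p E).
Local Notation o := (v 0%N).
Local Notation above := (above n v o p E).

Lemma above_start : above o.
Proof.
have [l1 e1 e2 r] := xp; split=> //; right; split=> //; try lia.
- move=> _ lt hh; apply: (no_corner_start cv erefl); last by left; exact: hh.
  left; rewrite [o]surjective_pairing; apply: r; lia.
Qed.

Lemma above_north (z : point) : above z -> above (z.1, z.2 + 1).
Proof.
move=> [l0 h]; split; first by rewrite /=; lia.
by case: h => /= [lt|[h1 h2 h3 h4]]; [left | right; split=> //; lia].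
Qed.

(** To get below the x-path, a horizontal step would have to cross a vertical run of it: in the
    interior of the run this is a T-junction of the chain, and at a corner the last clauses of
    [above] forbid it. *)
Lemma above_east (z : point) : above z -> hedge n v z -> z.2 <= p.2 -> z <> p ->
  above (z.1 + 1, z.2).
Proof.
have [l1 e1 e2 r] := xp.
have vr (x y : int) : o.1 <= x <= p.1 ->
  E x <= y < E (x + 1) \/ E (x + 1) <= y < E x -> vedge n v (x, y) by move=> hx; apply: r.
move=> [l0 h] hz zp zne; split=> //=.
case: (ltP (z.1 + 1) o.1) => lo; first by left.
right; case: (ltP z.1 o.1) => zo.
  have zo1 : z.1 + 1 = o.1 by lia.
  split=> /=; try (rewrite ?zo1 ?e1; lia).
  rewrite zo1 e1 => e lt _; apply: (no_corner_start cv erefl).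
    left; rewrite [o]surjective_pairing; apply: vr; rewrite ?e1; lia.
  by right; move: hz; congr hedge; apply: pointE => /=; lia.
case: h => [|[h1 h2 h3 h4]]; first lia.
have not_below : z.2 < E (z.1 + 1) -> False.
  move=> lt; have Ez : E z.1 <= z.2 by lia.
  have [e|ne] := eqVneq z.2 (E z.1); first by apply: h3 => //; lia.
  apply: (no_T_vert cv (z := z)); first by left.
    by rewrite [z]surjective_pairing; apply: vr; lia.
  by apply: vr; lia.
have Ez1 : E (z.1 + 1) <= z.2 by case: ltP => // /not_below.
(* In the last column [E] ends at height [p.2], so the point would be [p], where y-paths stop. *)
have z1p : z.1 + 1 <= p.1.
  case: (ltP z.1 p.1) => [|pz]; first lia.
  have zp1 : z.1 = p.1 by lia.
  by case: zne; apply: pointE => //; move: Ez1; rewrite zp1 e2; lia.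
split=> //=; first by left.
- move=> e lt hz1; apply: (no_T_horiz cv (z := (z.1 + 1, z.2))) => //=.
    by left; apply: vr; lia.
  by rewrite addrK -surjective_pairing.
- by move=> e lt; lia.
Qed.

Lemma above_west (z : point) : above (z.1 + 1, z.2) -> hedge n v z -> above z.
Proof.
have [l1 e1 e2 r] := xp.
have vr (x y : int) : o.1 <= x <= p.1 ->
  E x <= y < E (x + 1) \/ E (x + 1) <= y < E x -> vedge n v (x, y) by move=> hx; apply: r.
move=> [/= l0 h] hz; split=> //.
case: (ltP z.1 o.1) => zo; [by left | right].
case: h => [|/= [h1 h2 h3 h4]]; first lia.
have Ez1 : E (z.1 + 1) <= z.2.
  case: ltP => // lt; have lt2 : E (z.1 + 1 + 1) <= z.2 by lia.
  have [e|ne] := eqVneq z.2 (E (z.1 + 1 + 1)).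
    by case: h4 => //; [lia | rewrite addrK -surjective_pairing].
  case: (no_T_vert cv (z := (z.1 + 1, z.2))).
  - by right; rewrite /= addrK -surjective_pairing.
  - by apply: vr; lia.
  - by apply: vr => /=; lia.
split=> //; [lia | by right | by lia |].
move=> e lt hz1; apply: (no_T_horiz cv (z := z)) => //.
by left; rewrite [z]surjective_pairing; apply: vr; lia.
Qed.

(** A y-path never goes down, so the height bound is inherited by all its earlier points. *)
Lemma yreach_above (z : point) : yreach n v o p z -> z.2 <= p.2 -> above z.
Proof.
rewrite /yreach -{2 3}[z]transposeK.
elim=> [|w _ IH wp|w _ IH wp /vedge_transpose ew|w _ IH wp /vedge_transpose ew].
- by rewrite transposeK => _; exact: above_start.
- move=> /= lw; have /= := IH ltac:(rewrite /=; lia); exact: above_north.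
- move=> /= lw; have /= aw := IH lw; apply: (above_east aw) => //.
  by move=> e; apply: wp; rewrite -e transposeK.
- by move=> /= lw; have /= aw := IH lw; apply: (above_west (z := transpose w)).
Qed.

End Above.

(** Removes the stopping condition [z <> p] from the closure rules: once [p] is in [C], the weakened
    set [W] is everything. *)
Lemma or_stop_closed n v (p : point) (C : point -> Prop) (W := fun z => C z \/ C p)
  (CE : forall z : point, C z -> z <> p -> C (z.1 + 1, z.2))
  (CN : forall z : point, C z -> z <> p -> vedge n v z -> C (z.1, z.2 + 1))
  (CS : forall z : point, C (z.1, z.2 + 1) -> (z.1, z.2 + 1) <> p -> vedge n v z -> C z) :
  [/\ forall z : point, W z -> W (z.1 + 1, z.2),
      forall z : point, W z -> vedge n v z -> W (z.1, z.2 + 1)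
    & forall z : point, W (z.1, z.2 + 1) -> vedge n v z -> W z].
Proof.
split=> z [] Cz; rewrite /W; try tauto.
- by case: (eqVneq z p) => [e|/eqP e]; [right; rewrite -e | left; apply: CE].
- by move=> ez; case: (eqVneq z p) => [e|/eqP e]; [right; rewrite -e | left; apply: CN].
- move=> ez; case: (eqVneq (z.1, z.2 + 1) p) => [e|/eqP e]; first by right; rewrite -e.
  by left; apply: CS.
Qed.

(** The walk along [E] may hit [p] too early, so it is carried out in the weakened set [W], where
    membership of [p] still means that [p] is reached. *)
Lemma xpath_xreach n v (o p : point) E : xpath n v o p E -> xreach n v o p p.
Proof.
move=> [l1 e1 e2 r].
pose W (z : point) : Prop := xreach n v o p z \/ xreach n v o p p.
have [WE WN WS] : [/\ forall z : point, W z -> W (z.1 + 1, z.2),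
      forall z : point, W z -> vedge n v z -> W (z.1, z.2 + 1)
    & forall z : point, W (z.1, z.2 + 1) -> vedge n v z -> W z].
  exact: or_stop_closed (@xreachE n v o p) (@xreachN n v o p) (@xreachS n v o p).
suff : W p by case.
have Wup (x y : int) k : vrun n v x y (y + k%:Z) -> W (x, y) -> W (x, y + k%:Z).
  elim: k => [|k IHk] rx Wx; first by rewrite addr0.
  have -> : y + k.+1%:Z = y + k%:Z + 1 by lia.
  apply: (WN (x, y + k%:Z)); last by apply: rx; lia.
  by apply: IHk => // t ht; apply: rx; lia.
have Wdown (x y : int) k : vrun n v x (y + k%:Z) y -> W (x, y + k%:Z) -> W (x, y).
  elim: k => [|k IHk] rx Wx; first by rewrite addr0 in Wx.
  apply: IHk => [t ht|]; first by apply: rx; lia.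
  apply: (WS (x, y + k%:Z)); last by apply: rx; lia.
  by rewrite /=; move: Wx; congr W; congr (_, _); lia.
have Wrun (x y y' : int) : vrun n v x y y' -> W (x, y) -> W (x, y').
  case: (lerP y y') => le_y rx Wx.
    have ey : y' = y + `|(y' - y)%R|%N%:Z by lia.
    by rewrite ey; apply: Wup; rewrite -?ey.
  have ey : y = y' + `|(y - y')%R|%N%:Z by lia.
  by apply: (Wdown x y' `|(y - y')%R|%N); rewrite -?ey.
have main k : o.1 + k%:Z <= p.1 -> W (o.1 + k%:Z, E (o.1 + k%:Z)).
  elim: k => [|k IHk] hk.
    by rewrite addr0 e1 -surjective_pairing; left; exact: xreach0.
  have -> : o.1 + k.+1%:Z = o.1 + k%:Z + 1 by lia.
  apply: (WE (o.1 + k%:Z, _)); apply: (Wrun _ (E (o.1 + k%:Z))); last by apply: IHk; lia.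
  by apply: r; lia.
have := main `|(p.1 - o.1)%R|%N ltac:(lia).
have -> : o.1 + `|(p.1 - o.1)%R|%N%:Z = p.1 by lia.
rewrite [X in _ -> W X]surjective_pairing -e2; apply: Wrun; apply: r; lia.
Qed.

(** * Chains whose ends are joined by both kinds of path *)

Definition xjoined n (v : nat -> point) : Prop :=
  exists E, xpath n v (v 0%N) (v n.+1) E.

Definition yjoined n (v : nat -> point) : Prop :=
  xjoined n (fun i => transpose (v i)).

Lemma yjoined_yreach n v : yjoined n v -> yreach n v (v 0%N) (v n.+1) (v n.+1).
Proof. by move=> [E /xpath_xreach]. Qed.

Lemma yjoined_transpose n v : xjoined n v -> yjoined n (fun i => transpose (v i)).
Proof. by rewrite /yjoined transpose_dirK. Qed.

Lemma chain_endpoints n D v : chain n D v -> v n.+1 <> v 0%N.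
Proof.
move=> cv e; have [lk _ _] := cv.
have n0 : 0%N = n by apply: (chain_end cv (leq0n n)); rewrite e /on; lia.
by subst n; case: (lk 0%N isT) => -[_]; rewrite e; lia.
Qed.

(** The last step of the y-path decides. From the east it would come from outside the region above
    the x-path. From the west it uses the last segment, which then heads east. From below, the
    x-path must climb the edge under [p], so the last segment heads north. *)
Lemma joined_last n D v : chain n D v -> xjoined n v -> yjoined n v ->
  D n = east \/ D n = north.
Proof.
move=> cv [E xp] /yjoined_yreach yr; have [lk alt sim] := cv.
have [l1 e1 e2 r] := xp.
set p := v n.+1 in xp yr l1 e2 r.
have last_edge i : (i <= n)%N -> on (v i) (v i.+1) p -> i = n.
  exact: chain_end cv.
have no_vedge : yreach n v (v 0%N) p (p.1, p.2 - 1) -> vedge n v (p.1, p.2 - 1).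
  move=> /(yreach_above cv xp) /= h; have {h} [] := h ltac:(lia).
  move=> /= _ [|[_ h _ _]]; first lia.
  by apply: r; lia.
case: (yreach_inv yr (chain_endpoints cv)) => [[/no_vedge]|[_ _]|[yz _]].
- move=> [i le_in /andP[/= o1 o2]].
  have i_n : i = n.
    by apply: last_edge le_in _; move: o2; congr on; apply: pointE => /=; lia.
  subst i; move: o1; rewrite /on /= -/p.
  by case: (lk n (leqnn n)); rewrite -/p => -[-> h1 h2] o1; [left | lia | right | lia].
- move=> [i le_in /andP[/= o1 o2]].
  have i_n : i = n.
    by apply: last_edge le_in _; move: o2; congr on; apply: pointE => /=; lia.
  subst i; move: o1; rewrite /on /= -/p.
  by case: (lk n (leqnn n)); rewrite -/p => -[-> h1 h2] o1; [left | lia | right | lia].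
- have /= [_ /= [|[]]] := yreach_above cv xp yz (lexx _); lia.
Qed.

Lemma chain_pred n D v : chain n.+1 D v -> chain n D v.
Proof.
move=> [lk alt sim]; split=> [i le_in|i lt_in|i j z lt_ij le_jn].
- by apply: lk; lia.
- by apply: alt; lia.
- by apply: sim => //; lia.
Qed.

(* The y-path can reach p only from below, so it runs along the whole last
   segment; as it stays above the x-path, the latter passes through the bottom
   of that segment too. *)
Lemma peel_north n D v : chain n.+1 D v -> D n.+1 = north ->
  xjoined n.+1 v -> yjoined n.+1 v -> xjoined n v /\ yjoined n v.
Proof.
move=> cv DN [E xp] /yjoined_yreach yr; have [lk alt sim] := cv.
have [l1 e1 e2 r] := xp.
set p := v n.+2 in xp yr l1 e2 r; set q := v n.+1.
have [q1 q2] : q.1 = p.1 /\ q.2 < p.2.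
  by case: (lk n.+1 (leqnn _)) => -[]; rewrite DN -/p -/q.
have last_edge i : (i <= n.+1)%N -> on (v i) (v i.+1) p -> i = n.+1.
  exact: chain_end cv.
have no_hedge (z : point) : q.2 < z.2 <= p.2 -> z.1 = p.1 ->
    hedge n.+1 v z \/ hedge n.+1 v (z.1 - 1, z.2) -> False.
  move=> hz hz1 hh.
  have [i [le_in oz hi]] : exists i, [/\ (i <= n.+1)%N, on (v i) (v i.+1) z & ~~ vert (D i)].
    case: hh => -[i le_in /andP[/= o1 o2]]; exists i; split=> //.
    - by rewrite (seg_vert cv) //; move: o1 o2; rewrite /on /=; lia.
    - by move: o2; congr on; apply: pointE => /=; lia.
    - by rewrite (seg_vert cv) //; move: o1 o2; rewrite /on /=; lia.
  have [e|ne] := eqVneq i n.+1; first by move: hi; rewrite e DN.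
  have o1 : on (v n.+1) (v n.+2) z by rewrite /on -/p -/q; lia.
  have [_ e] := sim i n.+1 z ltac:(lia) (leqnn _) oz o1.
  by move: hz; rewrite e -/q; lia.
(* Traced back from [p], the y-path meets no horizontal edge above [q], so each step backwards goes
   down. *)
have ydown k : q.2 <= p.2 - 1 - k%:Z -> yreach n.+1 v (v 0%N) p (p.1, p.2 - 1 - k%:Z).
  elim: k => [|k IHk] hk.
    have -> : p.2 - 1 - 0%N%:Z = p.2 - 1 by lia.
    case: (yreach_inv yr (chain_endpoints cv)) => [[]//|[_ _ h]|[_ _ h]].
      by case: (no_hedge p); [lia | by [] | right].
    by case: (no_hedge p); [lia | by [] | left].
  have {IHk} yz := IHk ltac:(lia); set z := (_, _) in yz.
  have zo : z <> v 0%N.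
    move=> e; suff : n.+1 = 0%N by [].
    by apply: (chain_start cv (leqnn _)); rewrite -e /on -/p -/q /z /=; lia.
  case: (yreach_inv yz zo) => [[]|[_ _ h]|[_ _ h]].
  - by move=> + _; congr yreach; apply: pointE => /=; lia.
  - by case: (no_hedge z); rewrite /z /=; [lia | by [] | right].
  - by case: (no_hedge z); rewrite /z /=; [lia | by [] | left].
have yq : yreach n.+1 v (v 0%N) p q.
  have := ydown `|(p.2 - 1 - q.2)%R|%N ltac:(lia).
  by congr yreach; apply: pointE => /=; lia.
have Eq_le : E p.1 <= q.2.
  have [_ [|[_ h _ _]]] := yreach_above cv xp yq ltac:(lia); first lia.
  by move: h; rewrite q1 e2; lia.
(* An x-path entering the last column below [q] would use the edge under [q], which gives a
   T-junction with the last two segments. *)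
have Eq : E p.1 = q.2.
  apply/eqP; rewrite eq_le Eq_le /= leNgt; apply/negP => lt_E.
  have oq : on (v n.+1) (v n.+2) q by rewrite /on -/p -/q; lia.
  apply: (no_T_vert cv (z := q)); last 1 first.
  - by rewrite q1; apply: r; lia.
  - have le_n : (n <= n.+1)%N by [].
    have := alt n (ltnSn n); rewrite DN /=.
    have o1 : on (v n) (v n.+1) q by rewrite -/q /on; lia.
    case: (lk n le_n); rewrite -/q => -[-> h1 h2] // _; [right | left];
      by exists n => //; rewrite -/q /on /=; lia.
  - by exists n.+1 => //; rewrite -/p -/q /on /=; lia.
have vert_lt (x y : int) : x != p.1 -> vedge n.+1 v (x, y) -> vedge n v (x, y).
  move=> xp1 [i le_in oi]; exists i => //.
  case: (ltnP i n.+1) => // ge_i; have i_n : i = n.+1 by lia.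
  by subst i; move: oi; rewrite -/p -/q /on /=; lia.
have horiz_lt z : hedge n.+1 v z -> hedge n v z.
  move=> [i le_in oi]; exists i => //.
  case: (ltnP i n.+1) => // ge_i; have i_n : i = n.+1 by lia.
  by subst i; move: oi; rewrite -/p -/q /on /=; lia.
split.
  (* The x-path of the shorter chain stops on entering column [p.1], where its run becomes empty. *)
  exists (fun x => if x == p.1 + 1 then q.2 else E x); split=> /=; rewrite -/q.
  - by rewrite q1.
  - by case: eqP => //; lia.
  - by rewrite q1 eqxx.
  move=> x hx y; case: eqP => [|_]; first lia.
  case: eqP => [xp1|xp1] hy.
    have xe : x = p.1 by lia.
    by move: hy; rewrite xe Eq; lia.
  by apply: vert_lt; [lia | apply: (r x); lia].
have [F [f1 f2 f3 f4]] := xreach_xpath yq.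
exists F; split=> // x hx y hy.
by apply/vedge_transpose/horiz_lt/vedge_transpose; apply: f4 hy.
Qed.

(** Segments are peeled off from the end; when the last one heads east, [peel_north] applies after
    transposition. *)
Lemma joined_monotone n D v : chain n D v -> xjoined n v -> yjoined n v ->
  forall i, (i <= n)%N -> D i = east \/ D i = north.
Proof.
elim: n => [|n IHn] cv xj yj i.
  by rewrite leqn0 => /eqP ->; exact: joined_last cv xj yj.
have h := joined_last cv xj yj.
have [xj' yj'] : xjoined n v /\ yjoined n v.
  case: h => h; last exact: peel_north cv h xj yj.
  have [|yj' xj'] := peel_north (chain_transpose cv) _ yj (yjoined_transpose xj).
    by rewrite h.
  by move: xj'; rewrite /yjoined transpose_dirK.
rewrite leq_eqVlt => /orP[/eqP -> //|le_in].
exact: IHn (chain_pred cv) xj' yj' _ le_in.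
Qed.

(** * Moving a reachable point to an axis *)

Lemma reach_reduce_x n D v : chain n D v -> ~ xjoined n v ->
  reach n D ((v n.+1).1 - (v 0%N).1 - 1, (v n.+1).2 - (v 0%N).2).
Proof.
move=> cv nx; set p := v n.+1.
(* The set of points on x-paths contains the start but not the end, so its shift lowers the
   horizontal difference by one. *)
have nS : ~ xreach n v (v 0%N) p p by move=> /xreach_xpath.
have ok (z : point) : xreach n v (v 0%N) p z -> z <> p by move=> + e; rewrite e.
have [|z ez|v' cv' e'] := @reach_shift n D v (xreach n v (v 0%N) p) cv.
- by move=> z Sz; apply: xreachE => //; apply: ok.
- split=> Sz; first by apply: xreachN => //; apply: ok.
  by apply: xreachS => //; apply: ok.
exists v' => //; rewrite -e' /shift -/p.
case: asboolP => // _; case: asboolP => [_|]; last by case; exact: xreach0.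
by apply: pointE => /=; lia.
Qed.

(** The staircase condition read off from the directions: two successive turns cancel exactly when
    they are opposite. *)
Definition zigzag n (D : nat -> point) : Prop :=
  forall i, (i.+2 <= n)%N -> D i.+2 = D i.

Lemma zigzag_reflect n D : zigzag n (fun i => reflect (D i)) -> zigzag n D.
Proof. by move=> h i /h /(inv_inj reflectK). Qed.

Lemma zigzag_transpose n D : zigzag n (fun i => transpose (D i)) -> zigzag n D.
Proof. by move=> h i /h /(inv_inj transposeK). Qed.

(** If both kinds of path joined the ends, all segments would head east or north and, being
    alternately horizontal and vertical, form a zigzag. So one of the two shifts is available. *)
Lemma reach_reduce_pos n D (a b : int) : ~ zigzag n D ->
  reach n D (a, b) -> reach n D (a - 1, b) \/ reach n D (a, b - 1).
Proof.
move=> nz [v cv e].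
have [-> ->] : a = (v n.+1).1 - (v 0%N).1 /\ b = (v n.+1).2 - (v 0%N).2.
  by case: e => -> ->.
have [xj|nxj] := pselect (xjoined n v); last by left; apply: reach_reduce_x.
have [yj|nyj] := pselect (yjoined n v).
  have ne := joined_monotone cv xj yj; case: nz => i le_in.
  have [lk alt sim] := cv.
  have := alt i.+1 le_in; have := alt i (ltnW le_in).
  by case: (ne i) => [|->|->]; [lia|..]; case: (ne i.+1) => [|->|->]; try lia;
     case: (ne i.+2) => [|->|->]; rewrite ?le_in.
right; rewrite -(transpose_dirK D); have := reach_reduce_x (chain_transpose cv) nyj.
by move=> /reach_transpose.
Qed.

Definition inward (a : int) : int := if 0 < a then a - 1 else a + 1.

Lemma reach_reflect_y n D p : reach n D p ->
  reach n (fun i => transpose (reflect (transpose (D i)))) (p.1, - p.2).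
Proof. by move=> /reach_transpose/reach_reflect/reach_transpose. Qed.

Lemma reflect_y_dirK (D : nat -> point) :
  (fun i => transpose (reflect (transpose
     (transpose (reflect (transpose (D i))))))) = D.
Proof. by apply/funext => i; rewrite transposeK reflectK transposeK. Qed.

Lemma reach_reduce n D (a b : int) : ~ zigzag n D -> a != 0 -> b != 0 ->
  reach n D (a, b) -> reach n D (inward a, b) \/ reach n D (a, inward b).
Proof.
have pos D' (a' b' : int) : ~ zigzag n D' -> a' != 0 -> 0 < b' ->
    reach n D' (a', b') -> reach n D' (inward a', b') \/ reach n D' (a', b' - 1).
  move=> nz a0 b0 r; rewrite /inward; case: ltP => ha; first exact: reach_reduce_pos.
  have nz' : ~ zigzag n (fun i => reflect (D' i)) by move=> /zigzag_reflect.
  have [] := reach_reduce_pos nz' (reach_reflect r) => /reach_reflect;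
    rewrite reflect_dirK /reflect /= ?opprK; last by right.
  by rewrite opprD !opprK; left.
move=> nz a0 b0 r; rewrite {2}/inward; case: ltP => hb; first exact: pos.
have nz' : ~ zigzag n (fun i => transpose (reflect (transpose (D i)))).
  by move=> /zigzag_transpose/zigzag_reflect/zigzag_transpose.
have [||] := pos _ a (- b) nz' a0 _ (reach_reflect_y r); first lia;
  move=> /reach_reflect_y; rewrite reflect_y_dirK /= ?opprK; first by left.
by rewrite opprD !opprK; right.
Qed.

(** Membership of [a] in the half-line starting at [a'] and pointing away from 0, the trace of
    [Vplus (a', 0)] on the axis. *)
Definition beyond (a' a : int) : bool := (0 < a' <= a) || (a <= a' < 0).

(** Each reduction lowers [|a| + |b|] and crosses no axis, so the signs persist until a coordinate
    vanishes; both cannot vanish, as a chain is not closed. *)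
Lemma reach_axis n D (a b : int) : ~ zigzag n D -> reach n D (a, b) ->
  (exists2 a', beyond a' a & reach n D (a', 0)) \/
  (exists2 b', beyond b' b & reach n D (0, b')).
Proof.
move=> nz; have [k le_k] : exists k, (`|a|%N + `|b|%N <= k)%N by exists (`|a|%N + `|b|%N)%N.
elim: k a b le_k => [|k IHk] a b le_k r.
  case: r => v cv e; case: (chain_endpoints cv).
  have [a0 b0] : a = 0 /\ b = 0 by lia.
  by move: e; rewrite a0 b0 => -[e1 e2]; apply: pointE; lia.
have [b0|b0] := eqVneq b 0.
  subst b; have [a0|a0] := eqVneq a 0; first by apply: IHk => //; lia.
  by left; exists a => //; rewrite /beyond; lia.
have [a0|a0] := eqVneq a 0.
  by subst a; right; exists b => //; rewrite /beyond; lia.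
have [r'|r'] := reach_reduce nz a0 b0 r.
- case: (IHk _ _ _ r') => [|[a' ha ra]|[b' hb rb]]; last by right; exists b'.
    by rewrite /inward; case: ltP; lia.
  by left; exists a' => //; move: ha; rewrite /beyond /inward; case: (ltP 0 a); lia.
- case: (IHk _ _ _ r') => [|[a' ha ra]|[b' hb rb]]; last 1 first.
  + by right; exists b' => //; move: hb; rewrite /beyond /inward; case: (ltP 0 b); lia.
  + by rewrite /inward; case: ltP; lia.
  + by left; exists a'.
Qed.

(** * Hooks *)

Definition dirs n (D : nat -> point) : Prop :=
  (forall i, (i <= n)%N -> D i \in [:: east; west; north; south]) /\
  (forall i, (i < n)%N -> vert (D i.+1) = ~~ vert (D i)).

Lemma dirsP n D i : dirs n D -> (i <= n)%N ->
  [\/ D i = east, D i = west, D i = north | D i = south].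
Proof.
move=> [h _] /h; rewrite !inE => /or4P[] /eqP ->;
by [constructor 1|constructor 2|constructor 3|constructor 4].
Qed.

Lemma dirs_pred n D : dirs n.+1 D -> dirs n D.
Proof. by move=> [h1 h2]; split=> i hi; [apply: h1 | apply: h2]; lia. Qed.

Lemma dirs_transpose n D : dirs n D -> dirs n (fun i => transpose (D i)).
Proof.
move=> dD; split=> i hi.
  by case: (dirsP dD hi) => ->.
have := dD.2 i hi; case: (dirsP dD hi) => ->; by case: (dirsP dD (ltnW hi)) => ->.
Qed.

Lemma dirs_reflect n D : dirs n D -> dirs n (fun i => reflect (D i)).
Proof.
move=> dD; split=> i hi.
  by case: (dirsP dD hi) => ->.
have := dD.2 i hi; case: (dirsP dD hi) => ->; by case: (dirsP dD (ltnW hi)) => ->.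
Qed.

(** * Growing chains, and hooks that lead to an axis *)

Definition dot (d z : point) : int := d.1 * z.1 + d.2 * z.2.

(** The line through the end perpendicular to the last segment then meets the chain only there, so a
    segment of any length can follow after either turn. *)
Definition extreme n (D v : nat -> point) : Prop :=
  forall i, (i <= n)%N -> dot (D n) (v i) < dot (D n) (v n.+1).

Lemma chain_snoc_extreme n D v q : chain n D v -> extreme n D v ->
  dirs n.+1 D -> link (D n.+1) (v n.+1) q ->
  chain n.+1 D (fun i => if (i <= n.+1)%N then v i else q).
Proof.
move=> cv ex dD lq; have [lk alt sim] := cv.
apply: chain_snoc => //; first by case: dD => _; apply.
move=> j z le_jn oj oz.
have ej := ex j le_jn; have := dD.2 n (ltnSn n).
have [e|ne] := eqVneq j n.
  subst j; move: oj ej oz; rewrite /on /dot.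
  case: (lk n (leqnn n)) => -[-> h1 h2]; case: lq => -[-> h3 h4];
    rewrite /vert //= => oj ej oz _; split=> //; apply: pointE; lia.
have ej' := ex j.+1 ltac:(lia).
move: ej ej' oj oz; rewrite /on /dot.
by case: (lk n (leqnn n)) => -[-> h1 h2]; case: lq => -[-> h3 h4];
  rewrite /vert //= => ej ej' oj oz _; lia.
Qed.

Lemma bounded_dot n (d : point) (v : nat -> point) :
  exists M : int, forall i, (i <= n)%N -> dot d (v i) <= M.
Proof.
elim: n => [|n [M hM]].
  by exists (dot d (v 0%N)) => i; rewrite leqn0 => /eqP ->.
exists (if M <= dot d (v n.+1) then dot d (v n.+1) else M) => i.
rewrite leq_eqVlt => /orP[/eqP -> |/hM]; by case: ifP; lia.
Qed.

Lemma grow n D v : chain n D v -> extreme n D v -> dirs n.+1 D ->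
  exists v', [/\ chain n.+1 D v', extreme n.+1 D v' &
    forall i, (i <= n.+1)%N -> v' i = v i].
Proof.
move=> cv ex dD; have [M hM] := bounded_dot n.+1 (D n.+1) v.
pose d := D n.+1; pose p := v n.+1.
(* Long enough for the new end to pass every earlier vertex in direction [d]. *)
have [L [L0 hL]] : exists L : int, 0 < L /\ M - dot d p < L.
  by exists (`|M - dot d p| + 1); lia.
pose q : point := (p.1 + L * d.1, p.2 + L * d.2).
have lq : link d p q.
  rewrite /q; case: (dirsP dD (leqnn _)) => e; rewrite /d e;
    [constructor 1|constructor 2|constructor 3|constructor 4]; split=> //=; lia.
exists (fun i => if (i <= n.+1)%N then v i else q); split.
- exact: chain_snoc_extreme.
- move=> i le_i; rewrite le_i ltnn; have := hM i le_i.
  move: hL; rewrite -/d /q /dot /=.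
  by case: (dirsP dD (leqnn _)) => e; rewrite /dot /d e /=; lia.
- by move=> i ->.
Qed.

Lemma grown_chain n D : dirs n D -> exists2 v, chain n D v & extreme n D v.
Proof.
elim: n => [|n IHn] dD.
  exists (fun i => if i is 0%N then 0 else D 0%N).
    split=> [i|i|i j]; rewrite ?ltn0 //; last lia.
    rewrite leqn0 => /eqP ->.
    by case: (dirsP dD (leqnn _)) => ->;
      [constructor 1|constructor 2|constructor 3|constructor 4].
  move=> i; rewrite leqn0 => /eqP ->; rewrite /dot.
  by case: (dirsP dD (leqnn _)) => ->.
have [v cv ex] := IHn (dirs_pred dD).
by have [v' [cv' ex' _]] := grow cv ex dD; exists v'.
Qed.

Definition hook n (D : nat -> point) (d : point) : Prop :=
  exists i, [/\ (i.+2 <= n)%N, D i.+2 <> D i & D i.+1 = d].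

Lemma hook_reach_base n D : dirs n.+2 D -> D n.+1 = east -> D n.+2 <> D n ->
  exists2 a : int, 0 < a & reach n.+2 D (a, 0).
Proof.
move=> dD DE Dn; have dD1 := dirs_pred dD; have dD0 := dirs_pred dD1.
have [v cv ex] := grown_chain dD0.
have [v' [cv' ex' vE]] := grow cv ex dD1.
have ev0 := ex 0%N (leq0n n); rewrite -!vE // in ev0.
have ev1 := ex' 0%N (leq0n _); rewrite DE in ev1.
have l2 : (v' n.+1).2 = (v' n.+2).2.
  by have [lk _ _] := cv'; case: (lk n.+1 (leqnn _)) => -[]; rewrite DE.
(* Because of the hook, the last segment heads back to the row of the start, and it stays in the
   column of the rightmost vertex. *)
pose q : point := ((v' n.+2).1, (v' 0%N).2).
have lq : link (D n.+2) (v' n.+2) q.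
  have h1 := dD.2 n.+1 (ltnSn _); have h0 := dD.2 n (ltnW (ltnSn _)).
  rewrite DE in h1 h0; have le_n : (n <= n.+2)%N by lia.
  move: h1 h0 Dn ev0; rewrite /dot.
  case: (dirsP dD le_n) => ->; case: (dirsP dD (leqnn _)) => -> //= _ _ _ ev0;
    [constructor 4 | constructor 3]; split=> //=; lia.
have cq := chain_snoc_extreme cv' ex' dD lq.
exists ((v' n.+2).1 - (v' 0%N).1); first by move: ev1; rewrite /dot /=; lia.
by eexists; first exact: cq; rewrite /= ltnn; apply: pointE => /=; lia.
Qed.

Lemma reach_extend_axis n D : (0 < n)%N -> dirs n.+1 D ->
  (exists2 a : int, 0 < a & reach n D (a, 0)) ->
  exists2 a : int, 0 < a & reach n.+1 D (a, 0).
Proof.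
move=> n0 dD [a a0 ra]; have alt := dD.2 n (ltnSn n).
have Dn : vert (D n) \/ D n \in [:: east; west].
  by case: (dirsP dD (leqnSn n)) => ->; [right|right|left|left].
case: (dirsP dD (leqnn _)) => e; rewrite e in alt.
- exists (if 0 <= a then a + 1 else a); first by case: ifP; lia.
  by apply: reach_extend_east => //; move: alt; case: (vert (D n)).
(* After reflection the end lies to the left of the start, the case in which [reach_extend_east]
   keeps the difference. *)
- exists a => //; rewrite -(reflect_dirK D).
  have -> : (a, 0) = reflect (- a, 0) :> point by rewrite /reflect /= opprK.
  apply: reach_reflect; have := @reach_extend_east n (fun i => reflect (D i)) (- a) 0.
  rewrite ifN; last by lia.
  apply; first by rewrite e.
    by move: alt; rewrite /vert /=; lia.
  exact: (reach_reflect ra).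
- exists a => //; apply: reach_extend_north => //.
  by case: Dn => // h; rewrite h in alt.
- exists a => //; rewrite -(reflect_y_dirK D).
  apply: (@reach_reflect_y _ _ (a, 0)); apply: reach_extend_north => //.
  + by rewrite e.
  + case: Dn => [h|]; first by rewrite h in alt.
    by rewrite !inE => /orP[]/eqP ->.
  exact: (reach_reflect_y ra).
Qed.

Lemma hook_reach n D : dirs n D -> hook n D east ->
  exists2 a : int, 0 < a & reach n D (a, 0).
Proof.
move=> dD [i [le_in Di DE]]; elim: n le_in dD => // n IHn le_in dD.
move: le_in; rewrite leq_eqVlt => /orP[/eqP e|lt_in].
  by rewrite -e in dD *; apply: hook_reach_base.
by apply: reach_extend_axis => //; [lia | apply: IHn => //; apply: dirs_pred].
Qed.

(** * Paths of unit steps: from a point on the axis back to a hook *)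

Definition unit_step (p q : point) : Prop :=
  (q.2 = p.2 /\ (q.1 = p.1 + 1 \/ q.1 = p.1 - 1)) \/
  (q.1 = p.1 /\ (q.2 = p.2 + 1 \/ q.2 = p.2 - 1)).

(** Discrete intermediate value theorem. *)
Lemma step_ivt (f : nat -> int) (c : int) j : forall i, (i <= j)%N ->
  (forall k, (i <= k < j)%N -> `|f k.+1 - f k| <= 1) ->
  (f i <= c <= f j) || (f j <= c <= f i) ->
  exists k, (i <= k <= j)%N /\ f k = c.
Proof.
elim: j => [|j IHj] i le_ij st hc.
  by exists 0%N; move: hc le_ij; rewrite leqn0 => h /eqP e; split; subst; lia.
have [e|ne] := eqVneq (f j.+1) c; first by exists j.+1; rewrite le_ij leqnn.
have [ei|nei] := eqVneq i j.+1; first by exists i; subst i; lia.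
have [|k hk||k [hk fk]] := IHj i; [lia | by apply: st; lia | | by exists k; split=> //; lia].
by have := st j ltac:(lia); lia.
Qed.

(* By induction on j - i: if the path leaves the row of f i and only comes back
   at time j, its first and last steps are vertical and opposite, and the
   induction hypothesis applies to f i.+1 and f j.-1, on an adjacent row. *)
Lemma unit_path_hook (T : nat) (f : nat -> point) :
  (forall t, (t < T)%N -> unit_step (f t) (f t.+1)) ->
  (forall s t, (s < t <= T)%N -> f s <> f t) ->
  forall i j, (i < j <= T)%N -> (f i).2 = (f j).2 -> (f i).1 < (f j).1 ->
  (forall k, (i <= k <= j)%N -> (f k).2 = (f i).2) \/
  exists s t, [/\ (s.+1 < t)%N /\ (t < T)%N, (f s.+1).2 != (f s).2, (f s).2 = (f t.+1).2,
     (forall k, (s < k <= t)%N -> (f k).2 = (f s.+1).2) & (f s.+1).1 < (f t).1].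
Proof.
move=> st inj.
have ivt1 i j c : (i <= j <= T)%N ->
    ((f i).1 <= c <= (f j).1) || ((f j).1 <= c <= (f i).1) ->
    exists k, (i <= k <= j)%N /\ (f k).1 = c.
  move=> hij; apply: (@step_ivt (fun k => (f k).1)); first lia.
  by move=> k hk; have := st k ltac:(lia); rewrite /unit_step; lia.
have ivt2 i j c : (i <= j <= T)%N ->
    ((f i).2 <= c <= (f j).2) || ((f j).2 <= c <= (f i).2) ->
    exists k, (i <= k <= j)%N /\ (f k).2 = c.
  move=> hij; apply: (@step_ivt (fun k => (f k).2)); first lia.
  by move=> k hk; have := st k ltac:(lia); rewrite /unit_step; lia.
set H := exists s t, _.
have [//|nH] := pselect H; first by right.
(* Without a hook, each return to a row is either flat or strictly further left. *)
have main m : forall i j, (j - i <= m)%N -> (i < j <= T)%N -> (f i).2 = (f j).2 ->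
    (forall k, (i <= k <= j)%N -> (f k).2 = (f i).2) \/ (f j).1 < (f i).1.
  elim: m => [|m IHm] i j le_m hij e2; first lia.
  have [[k [hk ek]]|no_k] := pselect (exists k, (i < k < j)%N /\ (f k).2 = (f i).2).
    have h1 := IHm i k ltac:(lia) ltac:(lia) (esym ek).
    have h2 := IHm k j ltac:(lia) ltac:(lia) (etrans ek e2).
    case: h1 h2 => [s1|l1] [s2|l2].
    - left=> l hl; case: (leqP l k) => hlk; first by apply: s1; lia.
      by rewrite s2 ?ek //; lia.
    (* Otherwise the flat piece would already pass through [f j], against injectivity. *)
    - right; case: ltP => // le_j.
      have [l [hl el]] := ivt1 i k (f j).1 ltac:(lia) ltac:(lia).
      by case: (inj l j ltac:(lia)); apply: pointE => //; rewrite (s1 l) // e2.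
    - right; case: ltP => // le_j.
      have [l [hl el]] := ivt1 k j (f i).1 ltac:(lia) ltac:(lia).
      by case: (inj i l ltac:(lia)); apply: pointE => //; rewrite (s2 l) ?ek.
    - by right; lia.
  have nz k : (i < k < j)%N -> (f k).2 != (f i).2.
    by move=> hk; apply/eqP => ek; apply: no_k; exists k.
  have [ej|nej] := eqVneq j i.+1.
    by left=> l hl; have [->//|->] : l = i \/ l = j by lia.
  have si := st i ltac:(lia).
  have [t ejt] : exists t, j = t.+1 by exists j.-1; lia.
  subst j; have sj := st t ltac:(lia).
  have ni := nz i.+1 ltac:(lia); have nt := nz t ltac:(lia).
  (* If the path left and came back on different sides of the row, it would cross the row in
     between. *)
  have same : (f i.+1).2 = (f t).2.
    apply/eqP; apply: contraT => ne.
    have [k [hk ek]] := ivt2 i.+1 t (f i).2 ltac:(lia) ltac:(move: si sj; rewrite /unit_step; lia).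
    by have := nz k ltac:(lia); rewrite ek eqxx.
  have [x1 x2] : (f i.+1).1 = (f i).1 /\ (f t.+1).1 = (f t).1.
    by move: si sj; rewrite /unit_step; lia.
  have it : (i.+1 < t)%N.
    rewrite ltn_neqAle; apply/andP; split; last lia.
    apply/eqP => e; subst t; case: (inj i i.+2 ltac:(lia)).
    by apply: pointE; lia.
  case: (IHm i.+1 t ltac:(lia) ltac:(lia) same) => [s1|l1]; last by right; lia.
  right; have : (f i.+1).1 != (f t).1.
    by apply/eqP => e1; apply: (inj i.+1 t ltac:(lia)); apply: pointE.
  case: (ltP (f t).1 (f i.+1).1) => [|le_t ne]; first lia.
  (* A flat piece on the adjacent row that ends further right is a hook, excluded by [nH]. *)
  case: nH; exists i, t; split; [lia | by [] | by [] | by move=> k hk; apply: s1; lia | lia].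
move=> i j hij e2 lt1; left.
by case: (main _ i j (leqnn _) hij e2) => // ; lia.
Qed.

(* The unit step from f t to f t.+1 is on segment g t. *)
Definition unit_param (D v : nat -> point) k (T : nat) (f : nat -> point)
    (g : nat -> nat) : Prop :=
  [/\ f 0%N = v 0%N /\ f T = v k,
      forall t, (t < T)%N -> [/\ (g t < k)%N, on (v (g t)) (v (g t).+1) (f t),
         on (v (g t)) (v (g t).+1) (f t.+1), f t.+1 <> v (g t)
       & f t.+1 = ((f t).1 + (D (g t)).1, (f t).2 + (D (g t)).2)],
      forall t, (t.+1 < T)%N -> g t.+1 = g t \/ g t.+1 = (g t).+1
    & forall t, t.+1 = T -> (g t).+1 = k].

Lemma unit_param_ex n D v k : chain n D v -> (k <= n.+1)%N ->
  exists T f g, unit_param D v k T f g.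
Proof.
move=> [lk alt sim]; elim: k => [|k IHk] le_k.
  by exists 0%N, (fun=> v 0%N), (fun=> 0%N); split.
have [T [f [g [[f0 fT] st gst gl]]]] := IHk ltac:(lia).
have [L L0 vL] : exists2 L : nat, (0 < L)%N &
    v k.+1 = ((v k).1 + L%:Z * (D k).1, (v k).2 + L%:Z * (D k).2).
  case: (lk k ltac:(lia)) => -[-> h1 h2].
  - by exists `|((v k.+1).1 - (v k).1)%R|%N; [lia | apply: pointE => /=; lia].
  - by exists `|((v k.+1).1 - (v k).1)%R|%N; [lia | apply: pointE => /=; lia].
  - by exists `|((v k.+1).2 - (v k).2)%R|%N; [lia | apply: pointE => /=; lia].
  - by exists `|((v k.+1).2 - (v k).2)%R|%N; [lia | apply: pointE => /=; lia].
pose h (m : nat) : point := ((v k).1 + m%:Z * (D k).1, (v k).2 + m%:Z * (D k).2).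
have h0 : h 0%N = v k by apply: pointE; rewrite /= ?mul0r ?addr0.
have hon m : (m <= L)%N -> on (v k) (v k.+1) (h m).
  rewrite vL /on /h /=; case: (lk k ltac:(lia)) => -[-> h1 h2] /=; lia.
(* The two formulas for the path agree at [t = T], since [h 0 = v k]. *)
exists (T + L)%N, (fun t => if (t <= T)%N then f t else h (t - T)%N),
  (fun t => if (t < T)%N then g t else k).
split.
- rewrite leq0n f0; split=> //; rewrite ifN; last by rewrite -ltnNge; lia.
  by rewrite vL addKn.
- move=> t lt_t; case: (ltnP t T) => tT.
    rewrite (ltnW tT); have [g1 g2 g3 g4 g5] := st t tT; split=> //; lia.
  have -> : (if (t <= T)%N then f t else h (t - T)%N) = h (t - T)%N.
    case: leqP => // tT'; have -> : t = T by lia.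
    by rewrite subnn h0 fT.
  have -> : (t.+1 - T)%N = (t - T).+1 by lia.
  split; [lia | apply: hon; lia | apply: hon; lia | | ].
  + by rewrite -h0 /h => -[]; case: (lk k ltac:(lia)) => -[-> _ _] /=; lia.
  + by rewrite /h /=; congr (_, _); lia.
- move=> t lt_t; case: (ltnP t.+1 T) => tT; first by rewrite (ltnW tT); apply: gst.
  case: ltnP => tT'; last by left.
  by right; rewrite gl //; lia.
- by move=> t et; rewrite ifN //; lia.
Qed.

(** In the hook of the unit path, steps [s] and [t] are vertical and all steps between them
    horizontal; the latter lie on one segment [c.+1], and the former on its neighbours [c] and
    [c.+2]. *)
Lemma axis_hook n D v : chain n D v -> (0 < n)%N ->
  (v 0%N).2 = (v n.+1).2 -> (v 0%N).1 < (v n.+1).1 -> hook n D east.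
Proof.
move=> cv n0 e2 lt1; have [lk alt sim] := cv.
have [T [f [g [[f0 fT] st gst gl]]]] := unit_param_ex cv (leqnn _).
have T0 : (0 < T)%N.
  by case: (posnP T) => // eT; move: lt1; rewrite -fT eT f0; lia.
have gle t : (t < T)%N -> (g t <= n)%N by move=> /st[].
have steps t : (t < T)%N -> unit_step (f t) (f t.+1).
  move=> tT; have [_ _ _ _ ->] := st t tT; rewrite /unit_step /=.
  by case: (lk (g t) (gle t tT)) => -[-> _ _] /=; lia.
have gmono s t : (s <= t)%N -> (t < T)%N -> (g s <= g t)%N.
  elim: t => [|t IHt] hst tT; first by have -> : s = 0%N by lia.
  have [->//|ne] := eqVneq s t.+1.
  by have := IHt ltac:(lia) ltac:(lia); case: (gst t tT) => ->; lia.
have inj s t : (s < t <= T)%N -> f s <> f t.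
  case: t => [|t] hst; first lia.
  have tT : (t < T)%N by lia.
  have [g1 g2 g3 g4 g5] := st t tT.
  have [k1 k2 k3 k4 k5] := st s ltac:(lia).
  have := gmono s t ltac:(lia) tT; rewrite leq_eqVlt => /orP[/eqP eg|lg] ef.
    have run k : (s + k <= t)%N -> f (s + k).+1 =
        ((f s).1 + k.+1%:Z * (D (g s)).1, (f s).2 + k.+1%:Z * (D (g s)).2).
      elim: k => [|k IHk] hk; first by rewrite addn0 k5; congr (_, _); lia.
      have [_ _ _ _ ->] := st (s + k.+1)%N ltac:(lia).
      have -> : g (s + k.+1)%N = g s.
        by have := gmono s (s + k.+1)%N; have := gmono (s + k.+1)%N t; lia.
      by rewrite addnS IHk ?addSn /=; [congr (_, _); lia | lia].
    have := run (t - s)%N ltac:(lia); rewrite subnKC; last lia.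
    rewrite -ef; move: (lk (g s) ltac:(lia)) => lks e.
    have := congr1 fst e; have := congr1 snd e => /=.
    by case: lks => -[-> _ _] /=; lia.
  (* Two different segments can only share the start of the later one, and no step on a segment ends
     at its start. *)
  by rewrite -ef in g3 g4; have [_ e] := sim _ _ _ lg g1 k2 g3; apply: g4.
have horiz k : (k < T)%N -> (f k.+1).2 = (f k).2 -> ~~ vert (D (g k)).
  move=> kT; have [_ _ _ _ ->] := st k kT => /=.
  by case: (lk (g k) (gle k kT)) => -[-> _ _] /=; lia.
have gconst i j : (i <= j < T)%N ->
    (forall k, (i <= k <= j)%N -> ~~ vert (D (g k))) -> g j = g i.
  elim: j => [|j IHj] hij hh; first by have -> : i = 0%N by lia.
  have [->//|ne] := eqVneq i j.+1.
  have ej : g j = g i by apply: IHj => [|k hk]; [lia | apply: hh; lia].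
  case: (gst j ltac:(lia)) => [->//|eg].
  have := hh j.+1 ltac:(lia); rewrite eg alt; last first.
    by have := gle j.+1 ltac:(lia); lia.
  by have := hh j ltac:(lia); lia.
have g0 : g 0%N = 0%N.
  by have [h1 h2 _ _ _] := st 0%N T0; apply: (chain_start cv _); rewrite -?f0.
have [flat|[s [t [[h1 h2] h3 h4 h5 h6]]]] := unit_path_hook steps inj
  (i := 0%N) (j := T) ltac:(lia) ltac:(by rewrite f0 fT) ltac:(by rewrite f0 fT).
  (* A path that never leaves the row would stay on segment 0, against [n > 0]. *)
  have eT : g T.-1 = g 0%N.
    apply: gconst => [|k hk]; first lia.
    by apply: horiz; [lia | rewrite !flat //; lia].
  by have := gl T.-1 ltac:(lia); lia.
pose c := g s.
have [s1 s2 _ _ s5] := st s ltac:(lia); have [t1 t2 _ _ t5] := st t h2.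
have vs : vert (D c).
  move: h3; rewrite s5 -/c; case: (lk c s1) => -[-> _ _]; rewrite /vert /=; lia.
have e6 : (f t).2 = (f s.+1).2 by apply: h5; lia.
have vt : vert (D (g t)).
  have : (f t.+1).2 != (f t).2 by lia.
  by rewrite t5; case: (lk (g t) t1) => -[-> _ _]; rewrite /vert /=; lia.
have hk k : (s < k < t)%N -> ~~ vert (D (g k)).
  by move=> hk; apply: horiz; [lia | rewrite !h5 //; lia].
have gs1 : g s.+1 = c.+1.
  case: (gst s ltac:(lia)) => // e.
  by have := hk s.+1 ltac:(lia); rewrite e vs.
have gk k : (s < k < t)%N -> g k = c.+1.
  move=> hks; rewrite -gs1; apply: gconst => [|l hl]; first lia.
  by apply: hk; lia.
have gt : g t = c.+2.
  have [u eu] : exists u, t = u.+1 by exists t.-1; lia.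
  subst t; have gu := gk u ltac:(lia); case: (gst u h2) => e; last by rewrite e gu.
  by have := hk u ltac:(lia); rewrite -e vt.
exists c; split; first by rewrite -gt; lia.
- move=> e; move: h3 h4 e6; rewrite t5 s5 -/c gt e /=.
  by case: (lk c s1) => -[-> _ _] /=; lia.
- have := hk s.+1 ltac:(lia); rewrite gs1.
  case: (lk c.+1) => [|[-> _ _]//|[ew _ _]|[-> _ _]//|[-> _ _]//].
    by rewrite -gs1; apply: gle; lia.
  (* On a segment heading west the first coordinate could only decrease. *)
  suff dec k : (s < k <= t)%N -> (f k).1 <= (f s.+1).1.
    by have := dec t ltac:(lia); lia.
  elim: k => [|k IHk] hks; first lia.
  have [->//|ne] := eqVneq s k.
  have [_ _ _ _ ->] := st k ltac:(lia).
  rewrite gk ?ew /=; last lia.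
  by have := IHk ltac:(lia); lia.
Qed.

(** * From real chains to lattice chains *)

Lemma point_mulrn (d : point) k : d *+ k = (d.1 * k%:Z, d.2 * k%:Z) :> point.
Proof.
elim: k => [|k IHk]; first by rewrite mulr0n !mulr0.
by rewrite mulrS IHk; apply: pointE => /=; lia.
Qed.

Lemma direction0 s : direction s 0%N = east.
Proof. by rewrite /direction take0. Qed.

Lemma directionS s i : (i < size s)%N ->
  direction s i.+1 = rotate (direction s i) (nth TurnL s i).
Proof. by move=> lt_i; rewrite /direction (take_nth TurnL lt_i) foldl_rcons. Qed.

Lemma direction_dirs s : dirs (size s) (direction s).
Proof.
have mem i : (i <= size s)%N -> direction s i \in [:: east; west; north; south].
  elim: i => [|i IHi] le_i; first by rewrite direction0.
  have := IHi (ltnW le_i); rewrite directionS // !inE.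
  by case: (nth _ _ _) => /or4P[] /eqP ->.
split=> // i lt_i; have := mem i (ltnW lt_i); rewrite directionS // !inE.
by case: (nth _ _ _) => /or4P[] /eqP ->.
Qed.

Lemma direction_turn s i : (i.+2 <= size s)%N ->
  (direction s i.+2 == direction s i) = (nth TurnL s i != nth TurnL s i.+1).
Proof.
move=> lt_i; rewrite !directionS //; last by lia.
have := (direction_dirs s).1 i ltac:(lia); rewrite !inE.
by case: (nth _ _ _); case: (nth _ _ _) => /or4P[] /eqP ->.
Qed.

Lemma has_hook_hook s d : has_hook s d <-> hook (size s) (direction s) d.
Proof.
split=> -[i [h1 h2 h3]]; exists i; split=> //.
- by apply/eqP; rewrite direction_turn // h2 eqxx.
- by apply/eqP; move/eqP: h2; rewrite direction_turn // negbK.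
Qed.

Lemma staircaseP s : staircase s <-> zigzag (size s) (direction s).
Proof.
split=> [/(sortedP TurnL) h i lt_i|h]; last first.
  by apply/(sortedP TurnL) => i lt_i; rewrite -direction_turn // h.
by apply/eqP; rewrite direction_turn // h.
Qed.

Section Bridge.
Variable R : realType.

Lemma combination (a b c : int) : a != b -> (a <= c <= b) || (b <= c <= a) ->
  exists t : R, 0 <= t <= 1 /\ (1 - t) * a%:~R + t * b%:~R = c%:~R.
Proof.
move=> ne hc; have ne' : b%:~R - a%:~R != 0 :> R.
  by rewrite subr_eq0 eqr_int eq_sym.
exists ((c%:~R - a%:~R) / (b%:~R - a%:~R)); split; last first.
  by rewrite mulrBl mul1r -addrA [X in _ + X]addrC -mulrBr divfK // addrC subrK.
case/orP: hc => hc.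
  have lt : 0 < b%:~R - a%:~R :> R by rewrite subr_gt0 ltr_int; lia.
  by rewrite divr_ge0 ?ler_pdivrMr ?(ltW lt) //= ?subr_ge0 ?mul1r ?lerD2r !ler_int; lia.
have lt : 0 < a%:~R - b%:~R :> R by rewrite subr_gt0 ltr_int; lia.
rewrite -[X in X / _]opprB -[X in _ / X]opprB invrN mulrNN.
by rewrite divr_ge0 ?ler_pdivrMr ?(ltW lt) //= ?subr_ge0 ?mul1r ?lerD2l ?lerN2 !ler_int; lia.
Qed.

Lemma on_segment d p q z : link d p q -> on p q z -> segment R p q (embed R z).
Proof.
move=> lk oz; case: z oz => x y oz.
have horizontal : p.1 != q.1 -> p.2 = q.2 -> segment R p q (embed R (x, y)).
  move=> ne e; have [|t [t01 ht]] := @combination p.1 q.1 x ne.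
    by move: oz; rewrite /on /=; lia.
  exists t => //; congr (_, _); first exact: ht.
  have -> : y = p.2 by move: oz; rewrite /on /=; lia.
  by rewrite /= -e -mulrDl subrK mul1r.
have vertical : p.1 = q.1 -> p.2 != q.2 -> segment R p q (embed R (x, y)).
  move=> e ne; have [|t [t01 ht]] := @combination p.2 q.2 y ne.
    by move: oz; rewrite /on /=; lia.
  exists t => //; congr (_, _); last exact: ht.
  have -> : x = p.1 by move: oz; rewrite /on /=; lia.
  by rewrite /= -e -mulrDl subrK mul1r.
by case: lk => -[_ h1 h2];
  [apply: horizontal | apply: horizontal | apply: vertical | apply: vertical]; lia.
Qed.

Lemma combination_bound (a b : int) (t : R) : 0 <= t <= 1 ->
  (Order.min a b)%:~R <= (1 - t) * a%:~R + t * b%:~R <= (Order.max a b)%:~R.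
Proof.
move=> /andP[t0 t1].
have cE (c : R) : c = (1 - t) * c + t * c by rewrite -mulrDl subrK mul1r.
by apply/andP; split; [rewrite [leLHS]cE | rewrite [leRHS]cE];
  rewrite lerD // ler_wpM2l ?subr_ge0 // ler_int; lia.
Qed.

Lemma segment_box p q (z : R * R) : segment R p q z ->
  (Order.min p.1 q.1)%:~R <= z.1 <= (Order.max p.1 q.1)%:~R /\
  (Order.min p.2 q.2)%:~R <= z.2 <= (Order.max p.2 q.2)%:~R.
Proof. by move=> [t t01 <-]; split; apply: combination_bound. Qed.

(** Segments that meet in a real point have overlapping bounding boxes with integer corners, hence a
    common lattice point [w], and lattice simplicity applies. As one segment is vertical and the
    other horizontal, they fix both coordinates of [z], so [z] is [w]. *)
Lemma chain_simple_real n D v i j (z : R * R) : chain n D v -> (i < j)%N ->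
  (j <= n)%N -> segment R (v i) (v i.+1) z -> segment R (v j) (v j.+1) z ->
  j = i.+1 /\ z = embed R (v j).
Proof.
move=> cv lt_ij le_jn si sj; have [lk alt sim] := cv.
have [/andP[x1 x2] /andP[y1 y2]] := segment_box si.
have [/andP[x3 x4] /andP[y3 y4]] := segment_box sj.
have hx1 := le_trans x1 x4; have hx2 := le_trans x3 x2.
have hy1 := le_trans y1 y4; have hy2 := le_trans y3 y2.
rewrite !ler_int in hx1 hx2 hy1 hy2.
pose w : point := (Order.max (Order.min (v i).1 (v i.+1).1) (Order.min (v j).1 (v j.+1).1),
  Order.max (Order.min (v i).2 (v i.+1).2) (Order.min (v j).2 (v j.+1).2)).
have oi : on (v i) (v i.+1) w by rewrite /on /w /=; lia.
have oj : on (v j) (v j.+1) w by rewrite /on /w /=; lia.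
have [e ew] := sim i j w lt_ij le_jn oi oj; split=> //.
have vert1 k : (k <= n)%N -> vert (D k) -> segment R (v k) (v k.+1) z ->
    on (v k) (v k.+1) w -> z.1 = w.1%:~R.
  move=> le_k vk [t _ <-] ok; have ek : (v k).1 = (v k.+1).1.
    by apply/eqP; rewrite -(seg_vert cv).
  have -> : w.1 = (v k).1 by move: ok; rewrite /on; lia.
  by rewrite /= -ek -mulrDl subrK mul1r.
have horiz2 k : (k <= n)%N -> ~~ vert (D k) -> segment R (v k) (v k.+1) z ->
    on (v k) (v k.+1) w -> z.2 = w.2%:~R.
  move=> le_k vk [t _ <-] ok; have ek : (v k).2 = (v k.+1).2.
    by apply/eqP; move: vk; rewrite (seg_horiz cv) // negbK.
  have -> : w.2 = (v k).2 by move: ok; rewrite /on; lia.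
  by rewrite /= -ek -mulrDl subrK mul1r.
have le_in : (i <= n)%N by lia.
have vj : vert (D j) = ~~ vert (D i) by rewrite e alt //; lia.
rewrite -ew [z]surjective_pairing /embed; congr (_, _).
- by case hv: (vert (D i)); [apply: (vert1 i) | apply: (vert1 j) => //; rewrite vj hv].
- by case hv: (vert (D i)); [apply: (horiz2 j) => //; rewrite vj hv |
    apply: (horiz2 i) => //; rewrite hv].
Qed.

Lemma embed_inj : injective (embed R).
Proof.
by move=> p q [] /eqP; rewrite eqr_int => /eqP e1 /eqP; rewrite eqr_int => /eqP e2; apply: pointE.
Qed.

Lemma vertexS s l i : vertex s l i.+1 = vertex s l i + direction s i *+ nth 0%N l i.
Proof. by rewrite /vertex big_ord_recr. Qed.

Lemma vertex0 s l : vertex s l 0%N = 0.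
Proof. by rewrite /vertex big_ord0. Qed.

Lemma realizes_chain s l : realizes R s l -> chain (size s) (direction s) (vertex s l).
Proof.
move=> [sl pl sc]; have dD := direction_dirs s.
have lk i : (i <= size s)%N -> link (direction s i) (vertex s l i) (vertex s l i.+1).
  move=> le_i; have : (0 < nth 0%N l i)%N by apply: (allP pl); rewrite mem_nth ?sl.
  rewrite vertexS point_mulrn; case: (dirsP dD le_i) => -> h;
    [constructor 1|constructor 2|constructor 3|constructor 4]; split=> //=; lia.
split=> // [|i j z lt_ij le_j oi oj]; first exact: dD.2.
have si := on_segment (lk i ltac:(lia)) oi; have sj := on_segment (lk j le_j) oj.
have [|e ez] := sc i j (embed R z) lt_ij _ si sj; first by rewrite sl; lia.
by split=> //; apply: embed_inj ez.
Qed.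

Lemma chain_translate n D v (c : point) : chain n D v -> chain n D (fun i => v i - c).
Proof.
move=> [lk alt sim]; split=> // [i le_i|i j z lt_ij le_j oi oj].
  by case: (lk i le_i) => -[-> h1 h2];
    [constructor 1|constructor 2|constructor 3|constructor 4]; split=> //=; lia.
have [||-> e] := sim i j (z + c) lt_ij le_j.
- by move: oi; rewrite /on /=; lia.
- by move: oj; rewrite /on /=; lia.
by split=> //; rewrite -e addrK.
Qed.

Lemma chain_realizes s v : chain (size s) (direction s) v ->
  exists2 l, realizes R s l & vertex s l (size l) = v (size s).+1 - v 0%N.
Proof.
move=> /(chain_translate (v 0%N)) cv; pose w (i : nat) : point := v i - v 0%N.
have cw : chain (size s) (direction s) w by [].
have w0 : w 0%N = 0 by rewrite /w subrr.
have -> : v (size s).+1 - v 0%N = w (size s).+1 by [].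
clearbody w.
(* Only one of the two terms is nonzero, since the segment is parallel to an axis. *)
pose len i : nat :=
  (absz ((w i.+1).1 - (w i).1 : int) + absz ((w i.+1).2 - (w i).2 : int))%N.
have [lk alt sim] := cw.
have len_gt0 i : (i <= size s)%N -> (0 < len i)%N.
  by rewrite /len => le_i; case: (lk i le_i) => -[_ h1 h2]; lia.
pose l := mkseq len (size s).+1.
have vE i : (i <= (size s).+1)%N -> vertex s l i = w i.
  elim: i => [|i IHi] le_i; first by rewrite vertex0 w0.
  rewrite vertexS IHi ?(ltnW le_i) // nth_mkseq // point_mulrn.
  by apply: pointE; rewrite /len /=; case: (lk i le_i) => -[-> h1 h2] /=; lia.
exists l; last by rewrite size_mkseq vE.
split; first by rewrite size_mkseq.
  apply/(all_nthP 0%N) => i; rewrite size_mkseq => lt_i; rewrite nth_mkseq //=.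
  exact: len_gt0.
move=> i j z lt_ij; rewrite size_mkseq => lt_j.
rewrite !vE; try lia.
exact: (chain_simple_real cw).
Qed.

Lemma reachable_reach s p : reachable R s p <-> reach (size s) (direction s) p.
Proof.
split=> [[l rl <-]|[v cv ->]].
  exists (vertex s l); first exact: realizes_chain.
  by rewrite vertex0 subr0; case: rl => ->.
by have [l rl e] := chain_realizes cv; exists l.
Qed.

End Bridge.

(** * The reachable set *)

Definition stairs i : point := if odd i then north else east.

(** The two bounds count the segments heading east and north, each of length at least 1. Unit
    lengths attain the bounds, and all other points follow by moving outward. *)
Lemma reach_stairs n (p : point) : (0 < n)%N ->
  reach n stairs p <-> 1 + n./2%:Z <= p.1 /\ (uphalf n)%:Z <= p.2.
Proof.
move=> n0; split=> [[v [lk _ _] ->]|[h1 h2]].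
  have main i : (i <= n.+1)%N -> (uphalf i)%:Z <= (v i).1 - (v 0%N).1 /\
      i./2%:Z <= (v i).2 - (v 0%N).2.
    elim: i => [|i IHi] le_i; first by rewrite /=; lia.
    have := IHi (ltnW le_i); have := lk i le_i; rewrite /stairs.
    by case: ifP => oi -[] [] //= _; lia.
  by have := main n.+1 (leqnn _); rewrite /=; lia.
suff r : reach n stairs (1 + n./2%:Z, (uphalf n)%:Z).
  have out (a c : int) : 0 < a -> a <= c -> c = iter (absz (c - a)%R) outward a.
    by move=> a0 le_ac; rewrite iter_outward ?a0; lia.
  rewrite [p]surjective_pairing (out _ p.1 _ h1); last lia.
  rewrite (out _ p.2 _ h2); last lia.
  by apply: reach_outward; [lia | apply: reach_outward2 => //; lia].
exists (fun i => ((uphalf i)%:Z, i./2%:Z)); last by apply: pointE => /=; lia.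
split=> [i _|i _|i j z lt_ij le_j].
- by rewrite /stairs; case: ifP => oi; [constructor 3 | constructor 1]; split=> //=; lia.
- by rewrite /stairs /=; case: (odd i).
- by rewrite /on /= => oi oj; split; [lia | apply: pointE => /=; lia].
Qed.

Lemma reach_axis_hook n D : (0 < n)%N -> dirs n D ->
  (exists2 a : int, 0 < a & reach n D (a, 0)) <-> hook n D east.
Proof.
move=> n0 dD; split=> [[a a0 [v cv e]]|]; last exact: hook_reach.
have [e1 e2] : (v n.+1).1 - (v 0%N).1 = a /\ (v n.+1).2 - (v 0%N).2 = 0.
  by case: e => -> ->.
by apply: (axis_hook cv n0); lia.
Qed.

(** Lets reflection and transposition derive the other three half-axes from the positive x-axis. *)
Lemma hook_involution n D (f : point -> point) d : involutive f ->
  hook n (fun i => f (D i)) d <-> hook n D (f d).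
Proof.
move=> fK; split=> -[i [h1 h2 h3]]; exists i; split=> //.
- by move=> e; apply: h2; rewrite e.
- by rewrite -h3 fK.
- by move=> /(inv_inj fK).
- by rewrite h3 fK.
Qed.

Lemma reach_axis_hook_west n D : (0 < n)%N -> dirs n D ->
  (exists2 a : int, a < 0 & reach n D (a, 0)) <-> hook n D west.
Proof.
move=> n0 dD; rewrite -[west]/(reflect east) -(hook_involution _ _ _ reflectK).
rewrite -(reach_axis_hook n0 (dirs_reflect dD)); split=> -[a a0 ra].
- by exists (- a); [lia | exact: (reach_reflect ra)].
- by exists (- a); [lia | rewrite -(reflect_dirK D); exact: (reach_reflect ra)].
Qed.

Lemma reach_axis_transpose n D (b : int) :
  reach n (fun i => transpose (D i)) (b, 0) <-> reach n D (0, b).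
Proof.
by split=> /reach_transpose //; rewrite transpose_dirK.
Qed.

Lemma reach_axis_hook_north n D : (0 < n)%N -> dirs n D ->
  (exists2 b : int, 0 < b & reach n D (0, b)) <-> hook n D north.
Proof.
move=> n0 dD; rewrite -[north]/(transpose east) -(hook_involution _ _ _ transposeK).
rewrite -(reach_axis_hook n0 (dirs_transpose dD)).
by split=> -[b b0 /reach_axis_transpose rb]; exists b.
Qed.

Lemma reach_axis_hook_south n D : (0 < n)%N -> dirs n D ->
  (exists2 b : int, b < 0 & reach n D (0, b)) <-> hook n D south.
Proof.
move=> n0 dD; rewrite -[south]/(transpose west) -(hook_involution _ _ _ transposeK).
rewrite -(reach_axis_hook_west n0 (dirs_transpose dD)).
by split=> -[b b0 /reach_axis_transpose rb]; exists b.
Qed.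

(** * Closest points on the half-axes *)

Lemma exists_min_abs (P : int -> Prop) : (exists x, P x) ->
  exists2 a, P a & forall x, P x -> `|a| <= `|x|.
Proof.
move=> [x Px]; have [k le_k] : exists k, (absz x <= k)%N by exists (absz x).
elim: k x le_k Px => [|k IHk] x le_k Px.
  by exists x => // y _; lia.
have [[y [Py lt_y]]|no_y] := pselect (exists y : int, P y /\ (absz y < absz x)%N).
  by apply: (IHk y) => //; lia.
exists x => // y Py; case: (lerP `|x| `|y|) => // lt_y.
by case: no_y; exists y; split=> //; lia.
Qed.

Section HalfAxis.
Variables (A : set point) (h : int -> point) (P : set int).
Hypothesis hn : forall x, (h x).1 ^+ 2 + (h x).2 ^+ 2 = x ^+ 2.

(** Treats the four half-axes at once: [h] parametrizes an axis by signed distance and [P] selects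
    one half of it. Squared distances then compare like absolute values. *)
Lemma closest_half_axis : (exists2 x, P x & A (h x)) ->
  exists2 a, closest (A `&` [set h x | x in P]) (h a) &
    forall x, P x -> A (h x) -> `|a| <= `|x|.
Proof.
move=> [x Px Ax]; have [|a [Pa Aa] am] := @exists_min_abs (fun x => P x /\ A (h x)).
  by exists x.
exists a => [|y Py Ay]; last by apply: am.
split=> [|q [Aq [y Py eq]]]; first by split=> //; exists a.
rewrite -eq in Aq *; rewrite !hn -[a ^+ 2]real_normK ?num_real //.
rewrite -[y ^+ 2]real_normK ?num_real //.
by apply: lerXn2r; rewrite ?nnegrE ?normr_ge0 //; apply: am.
Qed.

Lemma closest_half_axis_mem p : closest (A `&` [set h x | x in P]) p ->
  A p /\ exists2 x, P x & p = h x.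
Proof. by move=> [[Ap [x Px e]] _]; split=> //; exists x. Qed.

End HalfAxis.

Lemma VplusP (a x y : int) : beyond a x -> Vplus (a, 0) (x, y).
Proof.
rewrite /beyond => h; exists (absz (x - a)) => //; exists y => //=; congr (_, _).
by case/orP: h => h; [rewrite gtr0_sg | rewrite ltr0_sg]; lia.
Qed.

Lemma HplusP (b x y : int) : beyond b y -> Hplus (0, b) (x, y).
Proof.
rewrite /beyond => h; exists x => //; exists (absz (y - b)) => //=; congr (_, _).
by case/orP: h => h; [rewrite gtr0_sg | rewrite ltr0_sg]; lia.
Qed.

Lemma Hplus_transpose (b : int) p : Hplus (0, b) p -> Vplus (b, 0) (transpose p).
Proof. by move=> [x _ [k _ <-]]; exists k => //; exists x. Qed.

Lemma reach_Hplus n D (b : int) : (0 < n)%N -> b != 0 -> reach n D (0, b) ->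
  forall p, Hplus (0, b) p -> reach n D p.
Proof.
move=> n0 b0 /reach_axis_transpose rb p /Hplus_transpose hp.
have := reach_Vplus n0 b0 rb hp => /reach_transpose.
by rewrite transpose_dirK transposeK.
Qed.

Lemma Qplus_pos (a b : int) p : 0 < a -> 0 < b ->
  Qplus (a, b) p <-> a <= p.1 /\ b <= p.2.
Proof.
move=> a0 b0; rewrite /Qplus /Vplus /Hplus /= !gtr0_sg //; split.
  by move=> [[i _ [y _ <-]] [x _ [j _ [_ <-]]]] /=; lia.
case: p => x y /= [h1 h2]; split.
  by exists (absz (x - a)) => //; exists y => //=; congr (_, _); lia.
by exists x => //; exists (absz (y - b)) => //=; congr (_, _); lia.
Qed.

Lemma Qplus_neg (a b : int) p : 0 < a -> 0 < b ->
  Qplus (a, - b) p <-> a <= p.1 /\ p.2 <= - b.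
Proof.
move=> a0 b0; rewrite /Qplus /Vplus /Hplus /= sgrN !gtr0_sg //; split.
  by move=> [[i _ [y _ <-]] [x _ [j _ [_ <-]]]] /=; lia.
case: p => x y /= [h1 h2]; split.
  by exists (absz (x - a)) => //; exists y => //=; congr (_, _); lia.
by exists x => //; exists (absz (y + b)) => //=; congr (_, _); lia.
Qed.

Lemma reach_ext n D D' p : (forall i, (i <= n)%N -> D i = D' i) ->
  reach n D p -> reach n D' p.
Proof.
move=> e [v [lk alt sim] ->]; exists v => //; split=> // [i le_i|i lt_i].
  by rewrite -e //; apply: lk.
by rewrite -!e ?alt //; lia.
Qed.

Lemma direction_stairs s i : staircase s -> ohead s = Some TurnL ->
  (i <= size s)%N -> direction s i = stairs i.
Proof.
move=> /(sortedP TurnL) st hd.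
have nthE j : (j < size s)%N -> nth TurnL s j = if odd j then TurnR else TurnL.
  elim: j => [|j IHj] lt_j; first by case: (s) hd => //= t r [->].
  have := st j lt_j; rewrite IHj; last by lia.
  by rewrite /=; case: (odd j); case: (nth _ _ _).
elim: i => [|i IHi] le_i; first by rewrite direction0.
rewrite directionS // IHi ?nthE //; last by lia.
by rewrite /stairs /=; case: (odd i).
Qed.

(** Exchanging left and right turns mirrors the chain in the x-axis, which fixes the initial
    direction. *)
Lemma direction_mirror s i :
  direction [seq (if t is TurnL then TurnR else TurnL) | t <- s] i =
  transpose (reflect (transpose (direction s i))).
Proof.
rewrite /direction -map_take; elim/last_ind: (take i s) => // r t IHr.
rewrite map_rcons !foldl_rcons IHr.
by case: t; apply: pointE; rewrite /= ?opprK.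
Qed.

Theorem theorem5 (R : realType) (s : seq turn) :
  [/\ size s = 0%N ->
        reachable R s = [set (a, 0) | a in [set a : int | 1 <= a]],
      staircase s -> ohead s = Some TurnL ->
        reachable R s =
          Qplus (1 + (size s)./2%:Z, (uphalf (size s))%:Z),
      staircase s -> ohead s = Some TurnR ->
        reachable R s =
          Qplus (1 + (size s)./2%:Z, - (uphalf (size s))%:Z)
    & ~~ staircase s ->
        reachable R s =
          (\bigcup_(a in xplus R s `|` xminus R s) Vplus (a, 0)) `|`
          (\bigcup_(b in yplus R s `|` yminus R s) Hplus (0, b))
        /\ [/\ (exists a, xplus R s a) <-> has_hook s east,
               (exists a, xminus R s a) <-> has_hook s west,
               (exists b, yplus R s b) <-> has_hook s north
             & (exists b, yminus R s b) <-> has_hook s south]].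
Proof.
have RE p : reachable R s p <-> reach (size s) (direction s) p.
  exact: reachable_reach.
split.
- move=> s0; apply/seteqP; split=> p.
    move=> /RE; rewrite s0 => -[v [lk _ _] ->].
    have := lk 0%N isT; rewrite direction0.
    case=> -[] // _ h1 h2; exists ((v 1%N).1 - (v 0%N).1); first by rewrite /=; lia.
    by apply: pointE => /=; lia.
  move=> [a /= a1 <-]; apply/RE; rewrite s0.
  exists (fun i => (if i is 0%N then 0 else a, 0)); last first.
    by apply: pointE; rewrite /= subr0.
  split=> [i|//|i j z]; last by lia.
  by rewrite leqn0 => /eqP ->; rewrite direction0; constructor 1; split=> //=; lia.
- move=> st hd; have n0 : (0 < size s)%N by case: (s) hd.
  have De i := direction_stairs (i := i) st hd.
  apply/seteqP; split=> p.
    move=> /RE/(reach_ext De)/(reach_stairs _ n0) h.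
    by apply/Qplus_pos => //; lia.
  move=> /Qplus_pos h; apply/RE; apply: (@reach_ext _ stairs) => [i le_i|].
    by rewrite De.
  by apply/reach_stairs => //; apply: h; lia.
- move=> st hd; have n0 : (0 < size s)%N by case: (s) hd.
  (* Mirroring reduces to staircases that begin with a left turn. *)
  pose s' := [seq (if t is TurnL then TurnR else TurnL) | t <- s].
  have ss' : size s' = size s by rewrite size_map.
  have st' : staircase s'.
    rewrite /staircase sorted_map; move: st; apply: sub_sorted.
    by move=> [] [].
  have hd' : ohead s' = Some TurnL by rewrite /s'; case: (s) hd => //= t r [->].
  have De i : (i <= size s)%N -> direction s' i = stairs i.
    by rewrite -ss'; exact: direction_stairs.
  have RE' p : reachable R s p <-> reach (size s) stairs (p.1, - p.2).
    rewrite RE; split=> [/reach_reflect_y|].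
      by apply: reach_ext => i le_i; rewrite -De // direction_mirror.
    move=> /reach_reflect_y /=; rewrite opprK -surjective_pairing.
    apply: reach_ext => i le_i; rewrite -De // direction_mirror.
    by rewrite transposeK reflectK transposeK.
  apply/seteqP; split=> p.
    move=> /RE'/(reach_stairs _ n0) h; apply/Qplus_neg; [lia | lia | move: h => /=; lia].
  move=> /Qplus_neg h; apply/RE'/reach_stairs => //=.
  by have := h ltac:(lia) ltac:(lia); lia.
- move=> nst; have nz : ~ zigzag (size s) (direction s).
    by move=> /staircaseP h; rewrite h in nst.
  have n0 : (0 < size s)%N.
    by rewrite lt0n; apply: contra nst => /eqP/size0nil ->.
  have dD := direction_dirs s.
  have hnx (x : int) : ((x, 0) : point).1 ^+ 2 + ((x, 0) : point).2 ^+ 2 = x ^+ 2.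
    by rewrite /= expr0n addr0.
  have hny (x : int) : ((0, x) : point).1 ^+ 2 + ((0, x) : point).2 ^+ 2 = x ^+ 2.
    by rewrite /= expr0n add0r.
  have xpm a : xplus R s a -> 0 < a /\ reach (size s) (direction s) (a, 0).
    by move=> /closest_half_axis_mem[/RE r [x x0 e]]; case: e r => ->.
  have xmm a : xminus R s a -> a < 0 /\ reach (size s) (direction s) (a, 0).
    by move=> /closest_half_axis_mem[/RE r [x x0 e]]; case: e r => ->.
  have ypm a : yplus R s a -> 0 < a /\ reach (size s) (direction s) (0, a).
    by move=> /closest_half_axis_mem[/RE r [x x0 e]]; case: e r => ->.
  have ymm a : yminus R s a -> a < 0 /\ reach (size s) (direction s) (0, a).
    by move=> /closest_half_axis_mem[/RE r [x x0 e]]; case: e r => ->.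
  have xpe a : 0 < a -> reach (size s) (direction s) (a, 0) ->
      exists2 c, xplus R s c & `|c| <= `|a|.
    move=> a0 /RE ra; have [|c h1 h2] := closest_half_axis (A := reachable R s)
      (P := [set x | 0 < x]) hnx; first by exists a.
    by exists c => //; apply: h2.
  have xme a : a < 0 -> reach (size s) (direction s) (a, 0) ->
      exists2 c, xminus R s c & `|c| <= `|a|.
    move=> a0 /RE ra; have [|c h1 h2] := closest_half_axis (A := reachable R s)
      (P := [set x | x < 0]) hnx; first by exists a.
    by exists c => //; apply: h2.
  have ype a : 0 < a -> reach (size s) (direction s) (0, a) ->
      exists2 c, yplus R s c & `|c| <= `|a|.
    move=> a0 /RE ra; have [|c h1 h2] := closest_half_axis (A := reachable R s)
      (P := [set x | 0 < x]) hny; first by exists a.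
    by exists c => //; apply: h2.
  have yme a : a < 0 -> reach (size s) (direction s) (0, a) ->
      exists2 c, yminus R s c & `|c| <= `|a|.
    move=> a0 /RE ra; have [|c h1 h2] := closest_half_axis (A := reachable R s)
      (P := [set x | x < 0]) hny; first by exists a.
    by exists c => //; apply: h2.
  split; last split.
  + apply/seteqP; split=> p.
      (* [reach_axis] gives a reachable axis point whose half-plane contains the given point. The
         closest one on the same half-axis is no further out, so its half-plane contains the point
         too. *)
      case: p => x y /RE /(reach_axis nz) [[a ha ra]|[b hb rb]].
        left; case: (ltP 0 a) => a0.
          have [c hc le_c] := xpe a a0 ra; exists c; first by left.
          by apply: VplusP; have [c0 _] := xpm c hc; move: ha; rewrite /beyond; lia.
        have [|c hc le_c] := xme a _ ra; first by move: ha; rewrite /beyond; lia.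
        exists c; first by right.
        by apply: VplusP; have [c0 _] := xmm c hc; move: ha; rewrite /beyond; lia.
      right; case: (ltP 0 b) => b0.
        have [c hc le_c] := ype b b0 rb; exists c; first by left.
        by apply: HplusP; have [c0 _] := ypm c hc; move: hb; rewrite /beyond; lia.
      have [|c hc le_c] := yme b _ rb; first by move: hb; rewrite /beyond; lia.
      exists c; first by right.
      by apply: HplusP; have [c0 _] := ymm c hc; move: hb; rewrite /beyond; lia.
    (* Conversely, a closest point is reachable and nonzero, and a reachable axis point brings its
       whole half-plane with it. *)
    move=> h; apply/RE; case: h => -[c hc hp].
      have [c0 rc] : c != 0 /\ reach (size s) (direction s) (c, 0).
        by case: hc => [/xpm|/xmm] [c0 rc]; split=> //; lia.
      exact: reach_Vplus c0 rc _ hp.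
    have [c0 rc] : c != 0 /\ reach (size s) (direction s) (0, c).
      by case: hc => [/ypm|/ymm] [c0 rc]; split=> //; lia.
    exact: reach_Hplus c0 rc _ hp.
  + rewrite has_hook_hook -(reach_axis_hook n0 dD).
    split=> [[a /xpm[a0 ra]]|[a a0 /(xpe a a0)[c hc _]]]; [by exists a | by exists c].
  + rewrite has_hook_hook -(reach_axis_hook_west n0 dD).
    split=> [[a /xmm[a0 ra]]|[a a0 /(xme a a0)[c hc _]]]; [by exists a | by exists c].
  + rewrite has_hook_hook -(reach_axis_hook_north n0 dD).
    split=> [[a /ypm[a0 ra]]|[a a0 /(ype a a0)[c hc _]]]; [by exists a | by exists c].
  + rewrite has_hook_hook -(reach_axis_hook_south n0 dD).
    split=> [[a /ymm[a0 ra]]|[a a0 /(yme a a0)[c hc _]]]; [by exists a | by exists c].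
Qed.
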